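(* Let $q$ be a prime power and $X\subseteq\mathbb{P}^2$ the Hermitian curve over $\mathbb{F}_{q^2}$. Fix three distinct non-collinear points $P_1,P_2,P_3\in X(\mathbb{F}_{q^2})$ and set $B:=X(\mathbb{F}_{q^2})\setminus\{P_1,P_2,P_3\}$. Fix an integer $d\ge5$ with $1\le d\le q-1$ and integers $a_1,a_2,a_3\in\{1,\dots,d\}$ such that $a_1+a_2+a_3\le 3d-5$ and $a_i=d$ for at most one index $i\in\{1,2,3\}$. Set $E:=a_1P_1+a_2P_2+a_3P_3$ and let $\mathcal{C}:=\mathcal{C}(B,d,-E)$. Then $\mathcal{C}$ has length $n=|B|=q^3-2$ and dimension $k=\binom{d+2}{2}-a_1-a_2-a_3$. For $i\in\{1,2,3\}$ let $L_i$ be the line spanned by $P_j$ and $P_h$, where $\{i,j,h\}=\{1,2,3\}$. Then $\mathcal{C}^\perp$ has minimum distance $d$, and its minimum-weight codewords are exactly those whose support consists of $d$ points of $B\cap L_i$ for some $i\in\{1,2,3\}$.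
   Context: $\mathbb{P}^2$ is the projective plane over $\mathbb{F}_{q^2}$ with coordinates $(x:y:z)$; the Hermitian curve $X$ is the plane curve with affine equation $y+y^q=x^{q+1}$ (smooth, degree $q+1$, with $q^3+1$ rational points). $E$ is viewed both as a divisor on $X$ and as a zero-dimensional subscheme of $\mathbb{P}^2$. $\mathcal{C}(B,d,-E)$ denotes the code obtained by evaluating $H^0(X,\mathcal{O}_X(d)(-E))$ (degree-$d$ forms on $X$ vanishing on the scheme $E$) at the points of $B$, after fixing a coordinate representative of each point; it is a linear subspace of $\mathbb{F}_{q^2}^{|B|}$ with coordinates indexed by $B$. $\mathcal{C}^\perp$ is the dual code with respect to the standard dot product; weight = number of nonzero coordinates; support = set of points of $B$ indexing nonzero coordinates; minimum distance = minimal weight of a nonzero codeword. *)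

(* Defs.v *)
From HB Require Import structures.
From mathcomp Require Import all_boot all_order all_algebra.
Set Implicit Arguments. Unset Strict Implicit. Unset Printing Implicit Defensive.
Import GRing.Theory.
Local Open Scope ring_scope.

Definition cx (R : Type) (v : 'rV[R]_3) : R := v ord0 (@Ordinal 3 0 isT).
Definition cy (R : Type) (v : 'rV[R]_3) : R := v ord0 (@Ordinal 3 1 isT).
Definition cz (R : Type) (v : 'rV[R]_3) : R := v ord0 (@Ordinal 3 2 isT).

(* Normalized representative of a point of P^2: nonzero vector whose first
   nonzero coordinate is 1.  Each point of P^2(F) has exactly one such
   representative; this is the fixed "coordinate representative". *)
Definition normalized (F : fieldType) (v : 'rV[F]_3) : bool :=
  [exists i : 'I_3, (v ord0 i == 1) && [forall j : 'I_3, (j < i)%N ==> (v ord0 j == 0)]].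

(* Homogenized Hermitian polynomial  y z^q + y^q z - x^(q+1)
   (affine equation y + y^q = x^(q+1) with z = 1), over any commutative ring. *)
Definition herm (R : comPzRingType) (q : nat) (x y z : R) : R :=
  y * z ^+ q + y ^+ q * z - x ^+ q.+1.

Definition hermPts (F : finFieldType) (q : nat) : {set 'rV[F]_3} :=
  [set v : 'rV[F]_3 | normalized v && (herm q (cx v) (cy v) (cz v) == 0)].

(* A degree-d form in x,y,z is given by coefficients c i j of the monomials
   x^i y^j z^(d-i-j), i + j <= d (coefficients with i + j > d are ignored).
   form_eval evaluates it at (x,y,z) in a commutative ring R. *)
Definition form_eval (R : comPzRingType) (d : nat) (c : 'I_d.+1 -> 'I_d.+1 -> R)
  (x y z : R) : R :=
  \sum_(i < d.+1) \sum_(j < d.+1 | (i + j <= d)%N)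
     c i j * x ^+ i * y ^+ j * z ^+ (d - i - j).

Definition jet (F : fieldType) (a : nat) (G : 'M[F]_(3, a)) (r : 'I_3) : {poly F} :=
  \sum_(k < a) G r k *: 'X^k.

(* The degree-d form with coefficient matrix M vanishes on the 0-dimensional
   subscheme a*P of X (P a rational point of X):  for every F[t]/(t^a)-point
   of X centered at P, i.e. every triple of polynomials gamma(t) with
   gamma(0) = P (representative) and herm(gamma) = 0 mod t^a, the pullback
   f(gamma(t)) is 0 mod t^a. *)
Definition vanishes_on_multiple (F : finFieldType) (q d a : nat)
  (M : 'M[F]_(d.+1, d.+1)) (P : 'rV[F]_3) : bool :=
  [forall G : 'M[F]_(3, a),
    let gx := jet G (@Ordinal 3 0 isT) in
    let gy := jet G (@Ordinal 3 1 isT) in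
    let gz := jet G (@Ordinal 3 2 isT) in
    [&& gx.[0] == cx P, gy.[0] == cy P & gz.[0] == cz P] ==>
    ('X^a %| herm q gx gy gz) ==>
    ('X^a %| form_eval (fun i j => (M i j)%:P) gx gy gz)].

Definition Bset (F : finFieldType) (q : nat) (P1 P2 P3 : 'rV[F]_3) : {set 'rV[F]_3} :=
  hermPts F q :\: [set P1; P2; P3].

Definition Bpt (F : finFieldType) (q : nat) (P1 P2 P3 : 'rV[F]_3)
  (k : 'I_#|Bset q P1 P2 P3|) : 'rV[F]_3 := enum_val k.

Definition evB (F : finFieldType) (q : nat) (P1 P2 P3 : 'rV[F]_3) (d : nat)
  (M : 'M[F]_(d.+1, d.+1)) : 'rV[F]_#|Bset q P1 P2 P3| :=
  \row_k (let v := Bpt k in form_eval (fun i j => M i j) (cx v) (cy v) (cz v)).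

Definition codeC (F : finFieldType) (q : nat) (P1 P2 P3 : 'rV[F]_3)
  (d a1 a2 a3 : nat) : {set 'rV[F]_#|Bset q P1 P2 P3|} :=
  [set evB q P1 P2 P3 M | M in [set M : 'M[F]_(d.+1, d.+1) |
      [&& vanishes_on_multiple q a1 M P1, vanishes_on_multiple q a2 M P2
        & vanishes_on_multiple q a3 M P3]]].

Definition dual_code (F : finFieldType) (n : nat) (C : {set 'rV[F]_n}) : {set 'rV[F]_n} :=
  [set w : 'rV[F]_n | [forall c in C, \sum_(i < n) c ord0 i * w ord0 i == 0]].

Definition code_dim (F : finFieldType) (n : nat) (C : {set 'rV[F]_n}) : nat :=
  \dim <<enum C>>%VS.

Definition weight (F : fieldType) (n : nat) (w : 'rV[F]_n) : nat :=
  #|[set i : 'I_n | w ord0 i != 0]|.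

Definition suppB (F : finFieldType) (q : nat) (P1 P2 P3 : 'rV[F]_3)
  (w : 'rV[F]_#|Bset q P1 P2 P3|) : {set 'rV[F]_3} :=
  [set Bpt k | k in [set k | w ord0 k != 0]].

Definition mx3 (F : fieldType) (u v w : 'rV[F]_3) : 'M[F]_3 :=
  \matrix_(i < 3, j < 3)
     (if (i == 0 :> nat) then u ord0 j else if (i == 1 :> nat) then v ord0 j else w ord0 j).

Definition line_through (F : finFieldType) (P Q : 'rV[F]_3) : {set 'rV[F]_3} :=
  [set R : 'rV[F]_3 | \det (mx3 R P Q) == 0].

(* Main.v *)
(* The Frobenius of a germ at a rational point P of the curve X is constant modulo t^q, so for a <= q
   the subscheme aP of X lies on the tangent line T_P: a form vanishes on E iff its restriction to
   each tangent T_i vanishes to order a_i at P_i.  Dividing successively by T_1, T_2, T_3 shows that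
   these conditions are independent in degrees d and d - 1.

   Let S be the support of a nonzero word of the dual code with |S| <= d; no form vanishing on E can
   be nonzero at exactly one point of S.  As T_i meets X(F) only at P_i, a product of T_1 T_2 T_3 with
   d - 3 lines isolates a point of S unless S is collinear.  If S lies on a line L through c of the
   P_i, then comparing dimensions in degrees d and d - 1 shows that the forms vanishing on E restrict
   to all polynomials of degree at most d on L that vanish at these c points, and a point of S is
   isolated again if |S| + c <= d + 1.  So c = 2 and |S| = d.  Conversely, d points of B on L_i carry
   a linear dependency, the restrictions to L_i forming a space of dimension d - 1.

   Forms are represented by the functions they induce on F^3, which is faithful because d < |F|. *)

Require Import Defs.
From HB Require Import structures.
From mathcomp Require Import all_boot all_order all_algebra all_field.
From mathcomp Require Import ring zify.
Set Implicit Arguments. Unset Strict Implicit. Unset Printing Implicit Defensive.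
Import GRing.Theory.
Local Open Scope ring_scope.

(** * Coordinates and determinants *)

Section Coordinates.
Variable F : fieldType.
Implicit Types u v w P Q R S : 'rV[F]_3.

(** The argument on a line [L] is a rank computation. A form vanishing on [L] is [L] times a form of
    degree [d - 1]; as [L] contains a point of [B] it is not a tangent, so the division lowers by
    exactly one the contact orders at the points [P_i] of [L]. The rank of the restriction is thus
    at least the dimension in degree [d] minus the dimension in degree [d - 1], and the numerical
    hypotheses come from the second term: in degree [d - 1] the successive tangents carry [d],
    [d - 1] and [d - 2] coefficients, so the largest multiplicity may be [d], the second at most
    [d - 1], the third at most [d - 2]. The second bound says that at most one [a_i] equals [d]; the
    third follows from the bound on the sum. Two costs of working with functions shape the
    statements: a linear factor cancels only under a degree bound, since functions have zero
    divisors, and the parametrization [P + t *: Q] misses the point [Q], where the value of a form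
    is its top coefficient. *)

Definition row3 (x y z : F) : 'rV[F]_3 :=
  \row_i (if i == 0 :> nat then x else if i == 1 :> nat then y else z).

Lemma cx_row3 x y z : cx (row3 x y z) = x. Proof. by rewrite /cx mxE. Qed.
Lemma cy_row3 x y z : cy (row3 x y z) = y. Proof. by rewrite /cy mxE. Qed.
Lemma cz_row3 x y z : cz (row3 x y z) = z. Proof. by rewrite /cz mxE. Qed.
Lemma cxD u v : cx (u + v) = cx u + cx v. Proof. by rewrite /cx mxE. Qed.
Lemma cyD u v : cy (u + v) = cy u + cy v. Proof. by rewrite /cy mxE. Qed.
Lemma czD u v : cz (u + v) = cz u + cz v. Proof. by rewrite /cz mxE. Qed.
Lemma cxZ a u : cx (a *: u) = a * cx u. Proof. by rewrite /cx mxE. Qed.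
Lemma cyZ a u : cy (a *: u) = a * cy u. Proof. by rewrite /cy mxE. Qed.
Lemma czZ a u : cz (a *: u) = a * cz u. Proof. by rewrite /cz mxE. Qed.
Lemma cx0 : cx (0 : 'rV[F]_3) = 0. Proof. by rewrite /cx mxE. Qed.
Lemma cy0 : cy (0 : 'rV[F]_3) = 0. Proof. by rewrite /cy mxE. Qed.
Lemma cz0 : cz (0 : 'rV[F]_3) = 0. Proof. by rewrite /cz mxE. Qed.

Definition coordE := (cx_row3, cy_row3, cz_row3, cxD, cyD, czD, cxZ, cyZ, czZ, cx0, cy0, cz0).

Lemma row3P u v : cx u = cx v -> cy u = cy v -> cz u = cz v -> u = v.
Proof.
move=> ex ey ez; apply/rowP=> -[[|[|[|//]]] i3]; [have:= ex|have:= ey|have:= ez];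
  by rewrite /cx /cy /cz (bool_irrelevance i3 isT) (_ : 0 = ord0) //; apply: val_inj.
Qed.

Lemma row3E u : u = row3 (cx u) (cy u) (cz u).
Proof. by apply: row3P; rewrite coordE. Qed.

Definition det3 u v w : F :=
  cx u * (cy v * cz w - cz v * cy w) - cy u * (cx v * cz w - cz v * cx w)
  + cz u * (cx v * cy w - cy v * cx w).

Lemma det_mx3 u v w : \det (mx3 u v w) = det3 u v w.
Proof.
rewrite (expand_det_row _ 0) !big_ord_recl big_ord0 /cofactor.
rewrite !(expand_det_row _ (0 : 'I_2)) !big_ord_recl !big_ord0 /cofactor !det_mx11 !mxE /=.
have eE (i : 'I_3) (t : 'rV[F]_3) : t ord0 i = [:: cx t; cy t; cz t]`_i.
  by case: i => [[|[|[|//]]] i3]; congr (t _ _); apply: val_inj.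
by rewrite !eE /bump /= /det3; ring.
Qed.

(** Stated through a completing vector because the proofs use [R] itself, in Cramer's rule and as a
    direction that leaves the line. *)
Definition independent P Q := exists R, det3 R P Q != 0.

(** Cramer's rule. For [v] on the line [PQ] the first term drops and the other two give the
    coordinates of [v] along [P] and [Q]. *)
Lemma cramer3 R P Q v :
  det3 R P Q *: v = det3 v P Q *: R + det3 R v Q *: P + det3 R P v *: Q.
Proof. by apply: row3P; rewrite !coordE /det3; ring. Qed.

Lemma normalizedP v : normalized v ->
  [\/ cx v = 1, cx v = 0 /\ cy v = 1 | [/\ cx v = 0, cy v = 0 & cz v = 1]].
Proof.
case/existsP=> -[[|[|[|//]]] i3] /andP[/eqP vi /forallP lt].
- by constructor 1; rewrite -vi; congr (v _ _); apply: val_inj.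
- have /eqP v0 := implyP (lt (@Ordinal 3 0 isT)) isT.
  by constructor 2; split=> //; rewrite -vi; congr (v _ _); apply: val_inj.
have /eqP v0 := implyP (lt (@Ordinal 3 0 isT)) isT.
have /eqP v1 := implyP (lt (@Ordinal 3 1 isT)) isT.
by constructor 3; split=> //; rewrite -vi; congr (v _ _); apply: val_inj.
Qed.

Lemma normalized_row3 v : normalized v =
  [|| cx v == 1, (cx v == 0) && (cy v == 1) | [&& cx v == 0, cy v == 0 & cz v == 1]].
Proof.
apply/idP/idP.
  by case/normalizedP=> [->|[-> ->]|[-> -> ->]]; rewrite !eqxx ?orbT.
case/or3P=> [vx|/andP[vx vy]|/and3P[vx vy vz]]; apply/existsP.
- by exists (@Ordinal 3 0 isT); rewrite [_ == 1]vx; apply/forallP=> j; apply/implyP.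
- exists (@Ordinal 3 1 isT); rewrite [_ == 1]vy; apply/forallP=> -[[|j] j3]; apply/implyP=> // _.
  by rewrite (bool_irrelevance j3 isT).
exists (@Ordinal 3 2 isT); rewrite [_ == 1]vz; apply/forallP=> -[[|[|j]] j3]; apply/implyP=> // _;
  by rewrite (bool_irrelevance j3 isT).
Qed.

Lemma normalized_neq0 v : normalized v -> v != 0.
Proof.
move=> nv; apply/eqP=> v0; move: nv; rewrite normalized_row3 v0 !coordE.
by rewrite eqxx eq_sym oner_eq0.
Qed.

(** Up to sign the minors [a], [b], [c] are determinants with a unit vector as first row, so a
    nonzero minor provides the witness. If all vanish, the vectors are proportional and
    normalization makes them equal. *)
Lemma normalized_free P Q : normalized P -> normalized Q -> P != Q -> independent P Q.
Proof.
move=> nP nQ nPQ.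
set a := cy P * cz Q - cz P * cy Q.
set b := cx P * cz Q - cz P * cx Q.
set c := cx P * cy Q - cy P * cx Q.
have [a0|a0] := eqVneq a 0; last by exists (row3 1 0 0);
  rewrite /det3 !coordE -/a mul1r !mul0r subr0 addr0.
have [b0|b0] := eqVneq b 0; last by exists (row3 0 1 0);
  rewrite /det3 !coordE -/b mul1r !mul0r addr0 sub0r oppr_eq0.
have [c0|c0] := eqVneq c 0; last by exists (row3 0 0 1);
  rewrite /det3 !coordE -/c mul1r !mul0r subr0 add0r.
case/eqP: nPQ; move: a0 b0 c0; rewrite /a /b /c.
have n10 : (1 : F) <> 0 by apply/eqP; rewrite oner_eq0.
case/normalizedP: nP=> [Px|[Px Py]|[Px Py Pz]]; case/normalizedP: nQ=> [Qx|[Qx Qy]|[Qx Qy Qz]];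
  rewrite ?Px ?Py ?Pz ?Qx ?Qy ?Qz ?mul0r ?mulr0 ?mul1r ?mulr1 ?subr0 ?sub0r => a0 b0 c0;
  try by [case: n10 | case: n10; apply: oppr_inj; rewrite oppr0].
- apply: row3P; rewrite ?Px ?Qx //; apply/eqP; rewrite eq_sym -subr_eq0; exact/eqP.
- by apply: row3P; rewrite ?Px ?Qx ?Py ?Qy //; apply/eqP; rewrite eq_sym -subr_eq0; exact/eqP.
- by apply: row3P; rewrite ?Px ?Qx ?Py ?Qy ?Pz ?Qz.
Qed.

Lemma normalized_scale v : v != 0 -> exists2 c, c != 0 & normalized (c *: v).
Proof.
move=> v0; have [x0|x0] := eqVneq (cx v) 0; last first.
  by exists (cx v)^-1; rewrite ?invr_eq0 // normalized_row3 !coordE mulVf // eqxx.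
have [y0|y0] := eqVneq (cy v) 0; last first.
  by exists (cy v)^-1; rewrite ?invr_eq0 // normalized_row3 !coordE mulVf // x0 mulr0 !eqxx orbT.
have [z0|z0] := eqVneq (cz v) 0.
  by case/eqP: v0; apply: row3P; rewrite !coordE.
exists (cz v)^-1; rewrite ?invr_eq0 // normalized_row3 !coordE mulVf // x0 y0 !mulr0 !eqxx.
by rewrite !orbT.
Qed.

End Coordinates.

(** * The Hermitian form *)

Section FieldOfOrderQ2.
Variables (F : finFieldType) (q : nat).
Hypothesis hq : exists p m : nat, [/\ prime p, (0 < m)%N & q = (p ^ m)%N].
Hypothesis hF : #|F| = (q ^ 2)%N.
Implicit Types (x y c t : F).

Lemma q_gt1 : (1 < q)%N.
Proof.
case: hq => p [m [pp m0 ->]]; apply: leq_trans (prime_gt1 pp) _.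
by rewrite -{1}(expn1 p) leq_exp2l // prime_gt1.
Qed.

Let q_gt0 : (0 < q)%N := ltnW q_gt1.

Lemma frobD x y : (x + y) ^+ q = x ^+ q + y ^+ q.
Proof.
case: hq => p [m [pp m0 eq_q]]; apply: exprDn_pchar.
have pF : p \in [pchar F] by apply: (@card_finPcharP _ p (m * 2)) => //; rewrite hF eq_q -expnM.
by rewrite eq_q pnatX (eq_pnat _ (pcharf_eq pF)) pnat_id.
Qed.

Lemma frobB x y : (x - y) ^+ q = x ^+ q - y ^+ q.
Proof. by apply/eqP; rewrite eq_sym subr_eq -frobD subrK. Qed.

Lemma frobN x : (- x) ^+ q = - x ^+ q.
Proof. by rewrite -[in LHS]sub0r frobB expr0n gtn_eqF // sub0r. Qed.

Lemma frobK x : (x ^+ q) ^+ q = x.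
Proof. by rewrite -exprM mulnn -hF expf_card. Qed.

Lemma card_root_le (p : {poly F}) n : p != 0 -> (size p <= n.+1)%N ->
  (#|[set t | root p t]| <= n)%N.
Proof.
move=> p0 sp; rewrite -ltnS; apply: leq_trans sp; rewrite cardE; apply: max_poly_roots => //.
  by apply/allP=> t; rewrite mem_enum inE.
exact: enum_uniq.
Qed.

Lemma card_trace_fiber_le c : (#|[set t : F | (t ^+ q + t == c)%R]| <= q)%N.
Proof.
have sp : size ('X^q + 'X - c%:P) = q.+1.
  rewrite -addrA size_polyDl size_polyXn //.
  by rewrite size_XsubC; have := q_gt1.
rewrite (_ : [set _ | _] = [set t | root ('X^q + 'X - c%:P) t]).
  by apply: card_root_le; rewrite ?sp // -size_poly_eq0 sp.
by apply/setP=> t; rewrite !inE /root !hornerE subr_eq0.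
Qed.

Lemma card_frob_fixed_le : (#|[set c : F | (c ^+ q == c)%R]| <= q)%N.
Proof.
have sp : size ('X^q - 'X : {poly F}) = q.+1.
  by rewrite size_polyDl size_polyXn // size_polyN size_polyX; have := q_gt1.
rewrite (_ : [set _ | _] = [set t | root ('X^q - 'X) t]).
  by apply: card_root_le; rewrite ?sp // -size_poly_eq0 sp.
by apply/setP=> t; rewrite !inE /root !hornerE subr_eq0.
Qed.

(* All fibres of the trace lie over the at most q fixed points of the Frobenius and have at most
   q elements, while the field has q^2 elements: all bounds are sharp. *)
Lemma card_trace_fiber c : c ^+ q = c -> #|[set t : F | (t ^+ q + t == c)%R]| = q.
Proof.
move=> cq; apply/eqP; rewrite eqn_leq card_trace_fiber_le /= leqNgt; apply/negP=> lt.
pose K := [set c : F | (c ^+ q == c)%R].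
have cK : c \in K by rewrite inE cq.
have : (#|F| < q ^ 2)%N; last by rewrite hF ltnn.
rewrite -sum1_card (partition_big (fun t : F => t ^+ q + t) (mem K)) /=; last first.
  by move=> t _; rewrite inE frobD frobK addrC.
rewrite (bigD1 c) //=.
have sum1 (b : F) : (\sum_(t : F | (t ^+ q + t == b)%R) 1 = #|[set t : F | (t ^+ q + t == b)%R]|)%N.
  by rewrite -sum1_card; apply: eq_bigl => t; rewrite inE.
rewrite sum1; apply: (@leq_trans (q + #|K :\ c| * q)); last first.
  rewrite -mulSn; apply: (@leq_trans (#|K| * q)); last by rewrite expnS expn1 leq_mul2r
    card_frob_fixed_le orbT.
  by rewrite (cardsD1 c K) cK.
rewrite -addSn; apply: leq_add => //.
rewrite -sum_nat_const [leqLHS](eq_bigl (fun b => b \in K :\ c)); last by move=> b;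
  rewrite !inE andbC.
by apply: leq_sum => b _; rewrite sum1; apply: card_trace_fiber_le.
Qed.

(** The Hermitian form that polarizes the equation of the curve: for [P] on the curve, [hform _ P]
    is the equation of the tangent at [P]. *)
Definition hform (u v : 'rV[F]_3) : F :=
  cy u * cz v ^+ q + cz u * cy v ^+ q - cx u * cx v ^+ q.

Lemma hermE v : herm q (cx v) (cy v) (cz v) = hform v v.
Proof. by rewrite /herm /hform exprS; ring. Qed.

Lemma hermPtsE v : (v \in hermPts F q) = normalized v && (hform v v == 0).
Proof. by rewrite inE hermE. Qed.

Lemma hformD u v w : hform (u + v) w = hform u w + hform v w.
Proof. by rewrite /hform !coordE; ring. Qed.

Lemma hformZ a u w : hform (a *: u) w = a * hform u w.
Proof. by rewrite /hform !coordE; ring. Qed.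

Lemma hformC u v : hform v u = hform u v ^+ q.
Proof. by rewrite /hform frobB frobD !exprMn !frobK; ring. Qed.

Lemma hformDr u v w : hform w (u + v) = hform w u + hform w v.
Proof. by rewrite /hform !coordE !frobD; ring. Qed.

Lemma hformZr a u w : hform w (a *: u) = a ^+ q * hform w u.
Proof. by rewrite /hform !coordE !exprMn; ring. Qed.

Lemma hform_nondegenerate u : (forall v, hform v u = 0) -> u = 0.
Proof.
move=> h; have z c : c ^+ q = 0 -> c = 0.
  by move/eqP; rewrite expf_eq0 => /andP[_ /eqP].
apply: row3P; rewrite !coordE; apply: z.
- by have := h (row3 (-1) 0 0); rewrite /hform !coordE => <-; ring.
- by have := h (row3 0 0 1); rewrite /hform !coordE => <-; ring.
- by have := h (row3 0 1 0); rewrite /hform !coordE => <-; ring.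
Qed.

(** For fixed [y != 0] the substitution [t = y^q z] turns the equation into [t^q + t = 1], because
    [y^(q^2) = y]; there is no solution with [y = 0]. *)
Lemma card_hermPts_affine :
  #|[set p : F * F | (p.1 * p.2 ^+ q + p.1 ^+ q * p.2 == 1)%R]| = ((q ^ 2).-1 * q)%N.
Proof.
rewrite -sum1_card (eq_bigl (fun p : F * F => true && (p.1 * p.2 ^+ q + p.1 ^+ q * p.2 == 1)%R));
  last first.
  by move=> p; rewrite inE.
rewrite -(pair_big_dep xpredT (fun y z : F => (y * z ^+ q + y ^+ q * z == 1)%R) (fun _ _ => 1%N)) /=.
rewrite (bigD1 (0 : F)) //= big1 ?add0n; last first.
  by move=> z; rewrite mul0r expr0n gtn_eqF // mul0r addr0 eq_sym oner_eq0.
rewrite (eq_bigr (fun=> q)).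
  rewrite sum_nat_const -hF; congr (_ * _)%N.
  by rewrite -(cardC1 (0 : F)); apply: eq_card => y; rewrite !inE.
move=> y y0; have yq0 : y ^+ q != 0 by rewrite expf_eq0 negb_and y0 orbT.
rewrite -[RHS](card_trace_fiber (expr1n _ q)) -sum1_card.
rewrite (reindex_onto (fun t => t / y ^+ q) (fun z => y ^+ q * z)) /=; last first.
  by move=> z _; rewrite mulrAC divff // mul1r.
apply: eq_bigl => t; rewrite inE expr_div_n frobK.
have yK z : z != 0 -> forall b : F, z * (b / z) = b by move=> z0 b; rewrite mulrCA divff ?mulr1.
by rewrite !yK // eqxx andbT.
Qed.

(** Splitting by the first nonzero coordinate gives [(q^2 - 1) q] points with [x = 1], then [q]
    solutions of [z^q + z = 0] with [x = 0] and [y = 1], and the point [(0 : 0 : 1)]. *)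
Lemma card_hermPts : #|hermPts F q| = (q ^ 3).+1.
Proof.
pose Y := [set p : F * F | (p.1 * p.2 ^+ q + p.1 ^+ q * p.2 == 1)%R].
pose Z := [set t : F | (t ^+ q + t == 0)%R].
have -> : hermPts F q = (fun p => row3 1 p.1 p.2) @: Y
    :|: ((fun t => row3 0 1 t) @: Z :|: [set row3 0 0 1]).
  apply/setP=> v; rewrite hermPtsE !inE; apply/andP/idP => [[nv /eqP hv]|].
    move: hv; rewrite /hform; case/normalizedP: nv => [vx|[vx vy]|[vx vy vz]];
      rewrite vx ?vy ?vz => hv.
    - apply/orP; left; apply/imsetP; exists (cy v, cz v); last by rewrite /= -vx -row3E.
      by rewrite inE /= -subr_eq0 -[X in _ == X]hv expr1n mulr1 [cz v * _]mulrC.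
    - apply/orP; right; apply/orP; left; apply/imsetP; exists (cz v); last by rewrite -vx -vy -row3E.
      by rewrite inE -[X in _ == X]hv expr1n mul0r subr0 mul1r mulr1.
    - by apply/orP; right; apply/orP; right; apply/eqP/row3P; rewrite !coordE.
  case/or3P=> [/imsetP[p]|/imsetP[t]|/eqP->].
  - rewrite inE => pY ->; split; first by rewrite normalized_row3 !coordE eqxx.
    by rewrite /hform !coordE expr1n mulr1 subr_eq0 [p.2 * _]mulrC.
  - rewrite inE => tZ ->; split; first by rewrite normalized_row3 !coordE !eqxx orbT.
    by rewrite /hform !coordE expr1n mul0r subr0 mul1r mulr1.
  - split; first by rewrite normalized_row3 !coordE !eqxx !orbT.
    by rewrite /hform !coordE expr0n gtn_eqF // !mul0r mulr0 subr0 addr0.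
have n10 : (1 == 0 :> F) = false by apply: oner_eq0.
rewrite cardsU card_imset; last first.
  case=> y z [y' z'] /= e; have := congr1 (@cy F) e; have := congr1 (@cz F) e.
  by rewrite !coordE => -> ->.
rewrite card_hermPts_affine cardsU card_imset; last first.
  by move=> z z' /(congr1 (@cz F)); rewrite !coordE.
rewrite card_trace_fiber ?expr0n ?gtn_eqF // cards1.
set I := setI _ _; have -> : I = set0.
  apply/setP=> v; rewrite !inE; apply/negP=> /andP[/imsetP[t _ ->] /eqP/(congr1 (@cy F))].
  by rewrite !coordE => /eqP; rewrite n10.
set J := setI _ _; have -> : J = set0.
  apply/setP=> v; rewrite !inE; apply/negP=> /andP[/imsetP[t _ ->]].
  case/orP=> [/imsetP[z _ /(congr1 (@cx F))]|/eqP/(congr1 (@cx F))];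
    by rewrite !coordE => /eqP; rewrite n10.
rewrite cards0 !subn0 addnA addn1 addnC -mulSn prednK ?expn_gt0 ?q_gt0 //.
by rewrite -expnSr.
Qed.

(** Otherwise [P] and [S] span a totally isotropic plane. Both [hform _ P] and [hform _ S] vanish on
    it, hence are proportional, and nondegeneracy carries the proportionality over to [P] and
    [S]. *)
Lemma tangent_only_at_point P S : P \in hermPts F q -> S \in hermPts F q -> P != S ->
  hform S P != 0.
Proof.
rewrite !hermPtsE => /andP[nP /eqP hP] /andP[nS /eqP hS] PS; apply/eqP=> hSP.
have [R D0] := normalized_free nP nS PS.
have hPS : hform P S = 0 by rewrite hformC hSP expr0n gtn_eqF.
have eP v : det3 R P S * hform v P = det3 v P S * hform R P.
  by rewrite -hformZ cramer3 !hformD !hformZ hP hSP !mulr0 !addr0.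
have eS v : det3 R P S * hform v S = det3 v P S * hform R S.
  by rewrite -hformZ cramer3 !hformD !hformZ hS hPS !mulr0 !addr0.
(* The form is [q]-semilinear in its second argument: the coefficients are conjugated here so that a
   second [q]-th power restores them. *)
have e0 : hform R S ^+ q *: P = hform R P ^+ q *: S.
  apply/eqP; rewrite -subr_eq0 -scaleNr; apply/eqP/hform_nondegenerate=> v.
  rewrite hformDr !hformZr frobN !frobK.
  apply: (mulfI D0); rewrite mulr0.
  transitivity (hform R S * (det3 R P S * hform v P) - hform R P * (det3 R P S * hform v S));
    first by ring.
  by rewrite eP eS; ring.
have RP0 : hform R P = 0.
  suff: hform R P ^+ q == 0 by rewrite expf_eq0 => /andP[_ /eqP].
  have: det3 R P (hform R P ^+ q *: S) = 0 by rewrite -e0 /det3 !coordE; ring.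
  have -> : det3 R P (hform R P ^+ q *: S) = hform R P ^+ q * det3 R P S by rewrite /det3 !coordE;
    ring.
  by move/eqP; rewrite mulf_eq0 (negPf D0) orbF.
case/negP: (normalized_neq0 nP); apply/eqP/hform_nondegenerate=> v.
by apply: (mulfI D0); rewrite eP RP0 !mulr0.
Qed.

(* The tangent line at P is spanned by P and T x e, for T the coefficient vector of the tangent and
   e a vector with P . e != 0. *)
Lemma tangent_line P : P \in hermPts F q ->
  exists Q c, c != 0 /\ forall v, det3 v P Q = c * hform v P.
Proof.
rewrite hermPtsE => /andP[nP /eqP hP].
pose a := - cx P ^+ q; pose b := cz P ^+ q; pose c := cy P ^+ q.
have hv v : hform v P = a * cx v + b * cy v + c * cz v by rewrite /hform /a /b /c; ring.
have {}hP : a * cx P + b * cy P + c * cz P = 0 by rewrite -hv.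
have [e pe] : exists e, cx P * cx e + cy P * cy e + cz P * cz e != 0.
  case/normalizedP: nP => [Px|[Px Py]|[Px Py Pz]]; [exists (row3 1 0 0)|exists (row3 0 1 0)|exists
    (row3 0 0 1)];
    by rewrite !coordE ?Px ?Py ?Pz !(mul0r, mulr0, mulr1, addr0, add0r) oner_eq0.
exists (row3 (b * cz e - c * cy e) (c * cx e - a * cz e) (a * cy e - b * cx e)).
exists (cx P * cx e + cy P * cy e + cz P * cz e); split=> // v.
rewrite hv /det3 !coordE; apply/eqP; rewrite -subr_eq0; apply/eqP.
transitivity (- (a * cx P + b * cy P + c * cz P) * (cx e * cx v + cy e * cy v + cz e * cz v));
  first by ring.
by rewrite hP oppr0 mul0r.
Qed.

End FieldOfOrderQ2.

(** * Forms as functions *)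

Lemma dim_limg_le (K : fieldType) (U V : vectType K) (f : 'Hom(U, V)) (W : {vspace U}) :
  (\dim (f @: W) <= \dim W)%N.
Proof. by rewrite -(limg_ker_dim f W) leq_addl. Qed.

Section FunctionSpaces.
Variable F : finFieldType.
Notation fun3 := {ffun 'rV[F]_3 -> F^o}.
Notation fun1 := {ffun F -> F^o}.
Implicit Types (P Q R u v : 'rV[F]_3) (f g : fun3) (p h G : {poly F}).

Lemma poly_fun_inj p h : (size p <= #|F|)%N -> (size h <= #|F|)%N ->
  (forall t, p.[t] = h.[t]) -> p = h.
Proof.
move=> sp sh e; apply/eqP; rewrite -subr_eq0; apply/negP=> /negP nz.
have s : (size (p - h)%R <= #|F|)%N.
  by apply: leq_trans (size_polyD _ _) _; rewrite size_polyN geq_max sp.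
have := @max_poly_roots _ _ (enum F) nz _ (enum_uniq _); rewrite -cardE ltnNge s.
by move=> H; suff: false by []; apply: H; apply/allP=> t _; rewrite /root !hornerE e subrr.
Qed.

Definition poly_fun G n (r : 'rV[F]_n) : fun1 := [ffun t => G.[t] * (rVpoly r).[t]].

Fact poly_fun_linear G n : linear (@poly_fun G n).
Proof.
by move=> a r s; apply/ffunP=> t; rewrite !ffunE linearP /= hornerD hornerZ mulrDr mulrCA.
Qed.
HB.instance Definition _ G n := GRing.isLinear.Build _ _ _ _ _ (@poly_fun_linear G n).

(** The target of restriction to a line; [G] records the imposed zeros, as a power of ['X] for
    contact at one point or a product of linear factors for several points. *)
Definition polyspace G n : {vspace fun1} := limg (linfun (@poly_fun G n)).

Lemma polyspaceP (f : fun1) G n :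
  reflect (exists2 p : {poly F}, (size p <= n)%N & forall t, f t = G.[t] * p.[t]) (f \in polyspace
    G n).
Proof.
apply: (iffP memv_imgP) => [[r _ ->]|[p sp e]].
  by exists (rVpoly r); rewrite ?size_poly // => t; rewrite lfunE ffunE.
by exists (poly_rV p); rewrite ?memvf //; apply/ffunP=> t; rewrite lfunE ffunE poly_rV_K.
Qed.

Lemma dim_polyspace_le G n : (\dim (polyspace G n) <= n)%N.
Proof.
apply: leq_trans (dim_limg_le _ _) _; by rewrite dimvf /dim /= mul1n.
Qed.

Lemma dim_polyspace G n : G != 0 -> (size G + n <= #|F|.+1)%N -> \dim (polyspace G n) = n.
Proof.
move=> G0 sG; rewrite /polyspace limg_dim_eq ?dimvf /dim /= ?mul1n //.
apply/eqP; rewrite -subv0; apply/subvP=> r /memv_capP[_].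
rewrite memv_ker lfunE /= => /eqP/ffunP e; rewrite memv0.
have : G * rVpoly r = 0.
  apply: poly_fun_inj => [||t]; rewrite ?size_poly0 //; last by have := e t;
    rewrite !ffunE hornerM horner0.
  have [->|r0] := eqVneq (rVpoly r) 0; first by rewrite mulr0 size_poly0.
  rewrite size_mul // -ltnS; apply: leq_trans sG.
  rewrite prednK ?leq_add2l ?size_poly //.
  by rewrite addn_gt0 lt0n size_poly_eq0 G0.
move/eqP; rewrite mulf_eq0 (negPf G0) /= => /eqP r0.
by apply/eqP; rewrite -[r]rVpolyK r0 linear0.
Qed.

Definition feval d (M : 'M[F]_(d.+1, d.+1)) : fun3 :=
  [ffun v => form_eval (fun i j => M i j) (cx v) (cy v) (cz v)].

Fact feval_linear d : linear (@feval d).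
Proof.
move=> a M N; apply/ffunP=> v; rewrite !ffunE /form_eval scaler_sumr -big_split /=.
apply: eq_bigr => i _; rewrite scaler_sumr -big_split /=; apply: eq_bigr => j _.
by rewrite !mxE !mulrDl /= -!mulrA.
Qed.
HB.instance Definition _ d := GRing.isLinear.Build _ _ _ _ _ (@feval_linear d).

Definition forms d : {vspace fun3} := limg (linfun (@feval d)).

Lemma formsP d f : reflect (exists M, f = @feval d M) (f \in forms d).
Proof.
apply: (iffP memv_imgP) => [[M _ ->]|[M ->]]; first by exists M; rewrite lfunE.
by exists M; rewrite ?memvf ?lfunE.
Qed.

Definition mono i j k : fun3 := [ffun v => cx v ^+ i * cy v ^+ j * cz v ^+ k].

Lemma fevalE d M : @feval d M =
  \sum_(i < d.+1) \sum_(j < d.+1 | (i + j <= d)%N) M i j *: mono i j (d - i - j).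
Proof.
apply/ffunP=> v; rewrite ffunE sum_ffunE /form_eval; apply: eq_bigr => i _.
rewrite sum_ffunE; apply: eq_bigr => j _.
by rewrite !ffunE /= -!mulrA.
Qed.

Lemma mono_forms i j k : mono i j k \in forms (i + j + k).
Proof.
have li : (i < (i + j + k).+1)%N by lia.
have lj : (j < (i + j + k).+1)%N by lia.
apply/formsP; exists (delta_mx (Ordinal li) (Ordinal lj)); rewrite fevalE.
rewrite (bigD1 (Ordinal li)) //= (bigD1 (Ordinal lj)) /=; last by lia.
rewrite !mxE !eqxx scale1r big1 ?addr0 => [|j' /andP[_ /negPf n]];
  last by rewrite !mxE n andbF scale0r.
rewrite big1 ?addr0 => [|i' /negPf n]; last by rewrite big1 // => j' _; rewrite !mxE n scale0r.
by congr (mono _ _ _); lia.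
Qed.

Lemma forms_ind d (K : fun3 -> Prop) : K 0 -> (forall a f g, K f -> K g -> K (a *: f + g)) ->
  (forall i j k, (i + j + k)%N = d -> K (mono i j k)) -> forall f, f \in forms d -> K f.
Proof.
move=> K0 KD Km f /formsP[M ->]; rewrite fevalE.
have KD1 g1 g2 : K g1 -> K g2 -> K (g1 + g2) by move=> K1 K2; rewrite -[g1]scale1r; apply: KD.
elim/big_ind: _ => // i _; elim/big_ind: _ => // j lij.
by rewrite -[_ *: _]addr0; apply: KD => //; apply: Km; lia.
Qed.

(** A predicate on plain functions, so that coordinates, determinants and tangents qualify without
    being repackaged. *)
Definition linform (l : 'rV[F]_3 -> F) := forall a u v, l (a *: u + v) = a * l u + l v.

Lemma linform0 l : linform l -> l 0 = 0.
Proof. by move=> ll; have := ll (-1) 0 0; rewrite scaler0 addr0 mulN1r addNr. Qed.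

Lemma linformE l : linform l -> forall v,
  l v = l (row3 1 0 0) * cx v + l (row3 0 1 0) * cy v + l (row3 0 0 1) * cz v.
Proof.
move=> ll v.
have {1}-> : v = cx v *: row3 1 0 0 + (cy v *: row3 0 1 0 + (cz v *: row3 0 0 1 + 0)).
  by apply: row3P; rewrite !coordE !(mulr1, mulr0, addr0, add0r).
by rewrite !ll linform0 //; ring.
Qed.

Lemma linform_det P Q : linform (fun v => det3 v P Q).
Proof. by move=> a u v; rewrite /det3 !coordE; ring. Qed.

Lemma linform_scale c l : linform l -> linform (fun v => c * l v).
Proof. by move=> ll a u v; rewrite ll; ring. Qed.

Lemma linform_add l m : linform l -> linform m -> linform (fun v => l v + m v).
Proof. by move=> ll lm a u v; rewrite ll lm; ring. Qed.

Lemma linform_hform q P : linform (fun v => hform q v P).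
Proof. by move=> a u v; rewrite hformD hformZ. Qed.

Lemma linform_cramer l R P Q v : linform l ->
  det3 R P Q * l v = det3 v P Q * l R + det3 R v Q * l P + det3 R P v * l Q.
Proof.
move=> ll; have lZ c u : l (c *: u) = c * l u by rewrite -[c *: u]addr0 ll linform0 // addr0.
by rewrite -lZ cramer3 -addrA !ll lZ addrA.
Qed.

Definition mulfun (l : 'rV[F]_3 -> F) (f : fun3) : fun3 := [ffun v => l v * f v].

Fact mulfun_linear l : linear (mulfun l).
Proof. by move=> a f g; apply/ffunP=> v; rewrite !ffunE mulrDr mulrCA. Qed.
HB.instance Definition _ l := GRing.isLinear.Build _ _ _ _ _ (mulfun_linear l).

Lemma mulfun_forms l d f : linform l -> f \in forms d -> mulfun l f \in forms d.+1.
Proof.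
move=> ll; elim/forms_ind: f / => [|a f g|i j k e]; first by rewrite linear0 mem0v.
  by move=> Kf Kg; rewrite linearP memvD ?memvZ.
have -> : mulfun l (mono i j k) = l (row3 1 0 0) *: mono i.+1 j k + l (row3 0 1 0) *: mono i j.+1 k
    + l (row3 0 0 1) *: mono i j k.+1.
  by apply/ffunP=> v; rewrite !ffunE /= (linformE ll) !exprS /GRing.scale /=; ring.
by rewrite !memvD ?memvZ //; [have := mono_forms i.+1 j k|have := mono_forms i j.+1 k|have :=
  mono_forms i j k.+1];
  rewrite -e ?addSn ?addnS.
Qed.

Definition restr P Q (f : fun3) : fun1 := [ffun t => f (P + t *: Q)].

Fact restr_linear P Q : linear (restr P Q).
Proof. by move=> a f g; apply/ffunP=> t; rewrite !ffunE. Qed.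
HB.instance Definition _ P Q := GRing.isLinear.Build _ _ _ _ _ (restr_linear P Q).

(** The homogenization of [h] in degree [e]. It retains the value at [(0, 1)], the point at infinity
    of the parametrization. *)
Definition binform e h (a b : F) : F := \sum_(k < e.+1) h`_k * a ^+ (e - k) * b ^+ k.

Lemma binform1 e h t : (size h <= e.+1)%N -> binform e h 1 t = h.[t].
Proof.
move=> sh; rewrite (horner_coef_wide _ sh); apply: eq_bigr => k _.
by rewrite expr1n mulr1.
Qed.

Lemma binformD e c h h' a b : binform e (c *: h + h') a b = c * binform e h a b + binform e h' a b.
Proof.
rewrite /binform mulr_sumr -big_split; apply: eq_bigr => k _.
by rewrite coefD coefZ /=; ring.
Qed.

Lemma binformS e h c c' a b : (size h <= e.+1)%N ->
  binform e.+1 (c *: h + c' *: ('X * h)) a b = (c * a + c' * b) * binform e h a b.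
Proof.
move=> sh; rewrite binformD -[c' *: _]addr0 binformD mulrDl.
have -> : binform e.+1 0 a b = 0 by apply: big1 => k _; rewrite coef0 !mul0r.
rewrite addr0; congr (_ + _); rewrite -mulrA; congr (_ * _).
  rewrite /binform big_ord_recr /= nth_default // !mul0r addr0 mulr_sumr.
  by apply: eq_bigr => k _; rewrite subSn ?exprS -1?ltnS //; ring.
rewrite /binform big_ord_recl /= coefXM eqxx !mul0r add0r mulr_sumr.
by apply: eq_bigr => k _; rewrite coefXM /= /bump /= add1n subSS exprS; ring.
Qed.

(** The possible cofactors of a linear form in degree [e]; for a constant only zero is left, which
    starts the dimension count. *)
Definition pred_forms e : {vspace fun3} := if e is e'.+1 then forms e' else 0%VS.

Lemma mulfun_pred_forms l e f : linform l -> f \in pred_forms e -> mulfun l f \in forms e.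
Proof.
move=> ll; case: e => [|e]; last exact: mulfun_forms.
by rewrite memv0 => /eqP->; rewrite linear0 mem0v.
Qed.

(* Euclidean division by the linear form that vanishes on the line PQ. *)
Lemma forms_decomposition P Q R e f : det3 R P Q != 0 -> f \in forms e ->
  exists g h, [/\ g \in pred_forms e, (size h <= e.+1)%N &
    forall v, f v = det3 v P Q * g v
      + binform e h (det3 R v Q / det3 R P Q) (det3 R P v / det3 R P Q)].
Proof.
move=> D0; set D := det3 R P Q.
pose lp v := det3 R v Q / D; pose lq v := det3 R P v / D.
have llp : linform lp by move=> a u v; rewrite /lp /det3 !coordE; ring.
have llq : linform lq by move=> a u v; rewrite /lq /det3 !coordE; ring.
pose K e f := f \in forms e /\ exists g h, [/\ g \in pred_forms e, (size h <= e.+1)%N &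
    forall v, f v = det3 v P Q * g v + binform e h (lp v) (lq v)].
have K0 n : K n 0.
  split; first exact: mem0v.
  exists 0, 0; split; rewrite ?mem0v ?size_poly0 // => v.
  by rewrite !ffunE mulr0 add0r /binform big1 // => k _; rewrite coef0 !mul0r.
have KD n a f1 f2 : K n f1 -> K n f2 -> K n (a *: f1 + f2).
  case=> V1 [g1 [h1 [Hg1 s1 e1]]] [V2 [g2 [h2 [Hg2 s2 e2]]]].
  split; first by rewrite memvD ?memvZ.
  exists (a *: g1 + g2), (a *: h1 + h2); split; first by rewrite memvD ?memvZ.
    apply: leq_trans (size_polyD _ _) _; rewrite geq_max s2 andbT.
    by apply: leq_trans (size_scale_leq _ _) s1.
  by move=> v; rewrite binformD !ffunE e1 e2 /GRing.scale /=; ring.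
(* Split [l] into a multiple of the equation of the line and a form [m] in [lp] and [lq] alone. The
   first part puts [f1] itself into the quotient, which is why [K] records that it is a form; the
   second multiplies quotient and remainder. *)
have KM n l f1 : linform l -> K n f1 -> K n.+1 (mulfun l f1).
  move=> ll [V1 [g [h [Hg s e1]]]]; split; first exact: mulfun_forms.
  pose m v := l P * lp v + l Q * lq v.
  have lm : linform m by apply: linform_add; apply: linform_scale.
  have lE v : l v = l R / D * det3 v P Q + m v.
    apply: (mulfI D0); rewrite linform_cramer // -/D /m /lp /lq.
    by field.
  exists ((l R / D) *: f1 + mulfun m g), (l P *: h + l Q *: ('X * h)); split.
  - by rewrite memvD ?memvZ ?mulfun_pred_forms.
  - apply: leq_trans (size_polyD _ _) _; rewrite geq_max.
    rewrite (leq_trans (size_scale_leq _ _)) ?(leq_trans s) //=.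
    by apply: leq_trans (size_scale_leq _ _) _; apply: leq_trans (size_polyMleq _ _) _;
      rewrite size_polyX.
  move=> v; rewrite binformS // !ffunE (lE v) /GRing.scale /= mulrDl.
  by rewrite {2}e1 /m; ring.
have Km n : forall i j k, (i + j + k)%N = n -> K n (mono i j k).
  elim: n => [|n IH] i j k e1.
    have [-> -> ->] : [/\ i = 0, j = 0 & k = 0]%N by split; lia.
    split; first by have := mono_forms 0 0 0.
    exists 0, 1; split; rewrite ?mem0v ?size_poly1 // => v.
    by rewrite !ffunE !expr0 /binform big_ord_recl big_ord0 coef1 !expr0 /=; ring.
  have lx : linform (@cx F) by move=> a u v; rewrite !coordE.
  have ly : linform (@cy F) by move=> a u v; rewrite !coordE.
  have lz : linform (@cz F) by move=> a u v; rewrite !coordE.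
  case: i e1 => [|i] e1; last first.
    have -> : mono i.+1 j k = mulfun (@cx F) (mono i j k) by apply/ffunP=> v;
      rewrite !ffunE exprS !mulrA.
    by apply: KM => //; apply: IH; lia.
  case: j e1 => [|j] e1; last first.
    have -> : mono 0 j.+1 k = mulfun (@cy F) (mono 0 j k).
      by apply/ffunP=> v; rewrite !ffunE exprS !mul1r !mulrA.
    by apply: KM => //; apply: IH; lia.
  case: k e1 => [|k] e1; first by lia.
  have -> : mono 0 0 k.+1 = mulfun (@cz F) (mono 0 0 k).
    by apply/ffunP=> v; rewrite !ffunE exprS !mul1r.
  by apply: KM => //; apply: IH; lia.
by move=> fV; have [] := forms_ind (K0 e) (KD e) (Km e) fV.
Qed.

End FunctionSpaces.

(** * Restriction to a line and the dimension of the space of forms *)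

Section Dimensions.
Variable F : finFieldType.
Notation fun3 := {ffun 'rV[F]_3 -> F^o}.
Notation fun1 := {ffun F -> F^o}.
Implicit Types (P Q R u v : 'rV[F]_3) (f g : fun3) (p h G : {poly F}).

Lemma form_eval_horner d (c : 'I_d.+1 -> 'I_d.+1 -> F) (x y z : {poly F}) t :
  (form_eval (fun i j => (c i j)%:P) x y z).[t] = form_eval c x.[t] y.[t] z.[t].
Proof.
rewrite /form_eval horner_sum; apply: eq_bigr => i _.
by rewrite horner_sum; apply: eq_bigr => j _; rewrite !hornerE.
Qed.

Lemma size_exp_mul_leq (p : {poly F}) m n : (size p <= m.+1)%N -> (size (p ^+ n)%R <= (n * m).+1)%N.
Proof.
move=> sp; apply: leq_trans (size_poly_exp_leq _ _) _.
by rewrite ltnS mulnC leq_mul2l; move: (size p) sp => s; lia.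
Qed.

Lemma size_form_eval d m (c : 'I_d.+1 -> 'I_d.+1 -> F) (x y z : {poly F}) :
  (size x <= m.+1)%N -> (size y <= m.+1)%N -> (size z <= m.+1)%N ->
  (size (form_eval (fun i j => (c i j)%:P) x y z) <= (d * m).+1)%N.
Proof.
move=> sx sy sz.
apply: leq_trans (size_sum _ _ _) _; apply/bigmax_leqP => i _.
apply: leq_trans (size_sum _ _ _) _; apply/bigmax_leqP => j ij.
rewrite -!mulrA mul_polyC; apply: leq_trans (size_scale_leq _ _) _.
have h1 := size_exp_mul_leq i sx; have h2 := size_exp_mul_leq j sy;
  have h3 := size_exp_mul_leq (d - i - j)%N sz.
have h4 := size_polyMleq (y ^+ j) (z ^+ (d - i - j)).
apply: leq_trans (size_polyMleq _ _) _.
have h5 : (i * m + (j * m + (d - i - j) * m) = d * m)%N.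
  by rewrite -!mulnDl; congr (_ * _)%N; lia.
move: (size _) (size _) (size _) (size _) h1 h2 h3 h4 h5 => s1 s2 s3 s4.
by move: (i * m)%N (j * m)%N ((d - i - j) * m)%N (d * m)%N; lia.
Qed.

Definition line_poly d (M : 'M[F]_(d.+1, d.+1)) P Q : {poly F} :=
  form_eval (fun i j => (M i j)%:P) ((cx P)%:P + cx Q *: 'X) ((cy P)%:P + cy Q *: 'X)
    ((cz P)%:P + cz Q *: 'X).

Lemma line_polyE d (M : 'M[F]_(d.+1, d.+1)) P Q t : (line_poly M P Q).[t] = feval M (P + t *: Q).
Proof.
rewrite /line_poly (form_eval_horner (fun i j => M i j)) ffunE !coordE.
by rewrite !hornerE; congr form_eval; rewrite mulrC.
Qed.

Lemma size_line_poly d (M : 'M[F]_(d.+1, d.+1)) P Q : (size (line_poly M P Q) <= d.+1)%N.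
Proof.
have s2 (a b : F) : (size (a%:P + b *: 'X)%R <= 2)%N.
  apply: leq_trans (size_polyD _ _) _; rewrite geq_max size_polyC.
  by rewrite (leq_trans (size_scale_leq _ _)) ?size_polyX // andbT; case: (a == 0).
by have := size_form_eval (fun i j => M i j) (s2 (cx P) (cx Q)) (s2 (cy P) (cy Q)) (s2 (cz P) (cz Q));
  rewrite muln1.
Qed.

Lemma forms_line_poly e f P Q : f \in forms F e ->
  exists2 p : {poly F}, (size p <= e.+1)%N & forall t, f (P + t *: Q) = p.[t].
Proof.
case/formsP=> M ->; exists (line_poly M P Q); first exact: size_line_poly.
by move=> t; rewrite line_polyE.
Qed.

Lemma independent_binform P Q e f : independent P Q -> f \in forms F e ->
  exists2 h : {poly F}, (size h <= e.+1)%N & forall a b, f (a *: P + b *: Q) = binform e h a b.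
Proof.
case=> R D0 /(forms_decomposition D0)[g [h [_ sh e1]]]; exists h => // a b.
rewrite e1; set v := a *: P + b *: Q.
have -> : det3 v P Q = 0 by rewrite /v /det3 !coordE; ring.
have -> : det3 R v Q = a * det3 R P Q by rewrite /v /det3 !coordE; ring.
have -> : det3 R P v = b * det3 R P Q by rewrite /v /det3 !coordE; ring.
by rewrite !mulfK // mul0r add0r.
Qed.

(** The remainder of the division by the line is a polynomial of degree at most [e] that vanishes at
    all [#|F|] parameters. *)
Lemma forms_divide P Q e f : independent P Q -> (e < #|F|)%N -> f \in forms F e ->
  restr P Q f = 0 -> exists2 g, g \in pred_forms F e & f = mulfun (fun v => det3 v P Q) g.
Proof.
case=> R D0 le_e /(forms_decomposition D0)[g [h [gV sh e1]]] /ffunP r0; exists g => //.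
suff h0 : h = 0.
  by apply/ffunP=> v; rewrite e1 ffunE h0 [binform _ _ _ _]big1 ?addr0 // => k _;
    rewrite coef0 !mul0r.
apply: poly_fun_inj; rewrite ?size_poly0 ?(leq_trans sh) // => t.
rewrite horner0; have := r0 t; rewrite !ffunE e1 => <-; set v := P + t *: Q.
have -> : det3 v P Q = 0 by rewrite /v /det3 !coordE; ring.
have -> : det3 R v Q = det3 R P Q by rewrite /v /det3 !coordE; ring.
have -> : det3 R P v = t * det3 R P Q by rewrite /v /det3 !coordE; ring.
by rewrite mulfK // divff // mul0r add0r binform1.
Qed.

(** A priori [g] vanishes only off the line. At a point [v] of the line, follow the direction [R]:
    the polynomial of [g] vanishes for [t != 0], so its product with ['X] vanishes everywhere and
    has degree below [#|F|]. *)
Lemma mulfun_det_inj P Q e g : independent P Q -> (e.+1 < #|F|)%N -> g \in forms F e ->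
  mulfun (fun v => det3 v P Q) g = 0 -> g = 0.
Proof.
case=> R D0 le_e gV /ffunP m0; apply/ffunP=> v; rewrite ffunE.
have g0 u : det3 u P Q != 0 -> g u = 0.
  move=> u0; have := m0 u; rewrite !ffunE => /eqP; rewrite mulf_eq0 (negPf u0) /=.
  by move/eqP.
have [v0|/g0//] := eqVneq (det3 v P Q) 0.
have [p sp pE] := forms_line_poly v R gV.
suff p0 : p = 0 by have := pE 0; rewrite scale0r addr0 p0 horner0.
have X0 : ('X : {poly F}) != 0 by rewrite polyX_eq0.
apply: (mulfI X0); rewrite mulr0; apply: poly_fun_inj; rewrite ?size_poly0 //.
  by apply: leq_trans (size_polyMleq _ _) _; rewrite size_polyX; apply: leq_ltn_trans sp le_e.
move=> t; rewrite hornerM hornerX horner0 -pE.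
have [->|t0] := eqVneq t 0; first by rewrite mul0r.
rewrite g0 ?mulr0 // (_ : det3 _ _ _ = det3 v P Q + t * det3 R P Q); last by rewrite /det3 !coordE;
  ring.
by rewrite v0 add0r mulf_neq0.
Qed.

Lemma linform_powers l m i j : linform l -> linform m ->
  [ffun v => l v ^+ i * m v ^+ j] \in forms F (i + j).
Proof.
move=> ll lm; elim: i => [|i IH]; first (elim: j => [|j IH]).
- rewrite (_ : finfun _ = mono F 0 0 0); first exact: (mono_forms F 0 0 0).
  by apply/ffunP=> v; rewrite !ffunE !expr0 !mulr1.
- rewrite (_ : finfun _ = mulfun m [ffun v => l v ^+ 0 * m v ^+ j]); first exact: mulfun_forms.
  by apply/ffunP=> v; rewrite !ffunE exprS; ring.
- rewrite (_ : finfun _ = mulfun l [ffun v => l v ^+ i * m v ^+ j]); first exact: mulfun_forms.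
  by apply/ffunP=> v; rewrite !ffunE exprS; ring.
Qed.

Lemma restr_forms P Q e : independent P Q ->
  (linfun (restr P Q) @: forms F e)%VS = polyspace 1 e.+1.
Proof.
case=> R D0; apply/eqP; rewrite eqEsubv; apply/andP; split; apply/subvP=> f.
  case/memv_imgP=> g gV ->; apply/polyspaceP; have [p sp pE] := forms_line_poly P Q gV.
  by exists p => // t; rewrite lfunE !ffunE pE hornerC mul1r.
case/polyspaceP=> p sp fE.
(* On [P + t *: Q] these linear forms take the values [1] and [t], so their products lift all
   monomials in [t]. *)
pose lp v := det3 R v Q / det3 R P Q; pose lq v := det3 R P v / det3 R P Q.
have llp : linform lp by move=> a u v; rewrite /lp /det3 !coordE; ring.
have llq : linform lq by move=> a u v; rewrite /lq /det3 !coordE; ring.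
pose g : fun3 := \sum_(k < e.+1) p`_k *: ([ffun v => lp v ^+ (e - k) * lq v ^+ k] : fun3).
apply/memv_imgP; exists g.
  apply: memv_suml => k _; apply: memvZ; have := linform_powers (e - k) k llp llq.
  by rewrite subnK // -ltnS.
apply/ffunP=> t; rewrite lfunE ffunE fE hornerC mul1r sum_ffunE (horner_coef_wide _ sp).
apply: eq_bigr => k _; rewrite !ffunE.
have -> : lp (P + t *: Q) = 1.
  by rewrite /lp (_ : det3 _ _ _ = det3 R P Q) ?divff // /det3 !coordE; ring.
have -> : lq (P + t *: Q) = t.
  by rewrite /lq (_ : det3 _ _ _ = t * det3 R P Q) ?mulfK // /det3 !coordE; ring.
by rewrite expr1n mul1r.
Qed.

Lemma exists_independent : exists P Q, @independent F P Q.
Proof.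
exists (row3 0 1 0), (row3 0 0 1), (row3 1 0 0).
by rewrite /det3 !coordE (_ : _ - _ + _ = 1) ?oner_eq0 //; ring.
Qed.

(** The restriction to a line has rank [e + 1], its kernel consists of the multiples of the line,
    and Pascal's rule adds the two dimensions. *)
Lemma dim_forms e : (e < #|F|)%N -> \dim (forms F e) = 'C(e.+2, 2).
Proof.
elim: e => [|e IH] le_e; have [P [Q PQ]] := exists_independent;
  rewrite -(limg_ker_dim (linfun (restr P Q))) restr_forms //;
  rewrite dim_polyspace ?oner_eq0 // ?size_poly1 // ?add1n //.
  suff -> : (forms F 0 :&: lker (linfun (restr P Q)))%VS = 0%VS by rewrite dimv0.
  apply/eqP; rewrite -subv0; apply/subvP=> f /memv_capP[fV].
  rewrite memv_ker lfunE /= => /eqP /(forms_divide PQ le_e fV)[g].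
  by rewrite memv0 => /eqP-> ->; rewrite linear0 mem0v.
have -> : (forms F e.+1 :&: lker (linfun (restr P Q)))%VS =
    (linfun (mulfun (fun v => det3 v P Q)) @: forms F e)%VS.
  apply/eqP; rewrite eqEsubv; apply/andP; split; apply/subvP=> f.
    case/memv_capP=> fV; rewrite memv_ker lfunE /= => /eqP /(forms_divide PQ le_e fV)[g gV ->].
    by apply/memv_imgP; exists g; rewrite ?lfunE.
  case/memv_imgP=> g gV ->; rewrite lfunE; apply/memv_capP; split.
    by apply: mulfun_forms => //; apply: linform_det.
  rewrite memv_ker lfunE; apply/eqP/ffunP=> t; rewrite !ffunE.
  by rewrite (_ : det3 _ _ _ = 0) ?mul0r // /det3 !coordE; ring.
rewrite limg_dim_eq ?IH ?(ltnW le_e) //; first by rewrite [RHS]binS bin1.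
apply/eqP; rewrite -subv0; apply/subvP=> f /memv_capP[fV].
by rewrite memv_ker lfunE memv0 => /eqP /(mulfun_det_inj PQ le_e fV) ->.
Qed.

(** Here [W] has to contain all cofactors of the members of [U] that vanish on the line. The bound
    serves twice: for the tangents in the count of conditions, and for the line that carries a
    support. *)
Lemma dim_le_restr (U W : {vspace fun3}) e P Q :
  independent P Q -> (e.+1 < #|F|)%N -> (U <= forms F e.+1)%VS ->
  (forall g, g \in forms F e -> mulfun (fun v => det3 v P Q) g \in U -> g \in W) ->
  (\dim U <= \dim (linfun (restr P Q) @: U)%VS + \dim W)%N.
Proof.
move=> PQ le_e UV UW; rewrite -{1}(limg_ker_dim (linfun (restr P Q))) addnC leq_add2l.
apply: leq_trans (dim_limg_le (linfun (mulfun (fun v => det3 v P Q))) W).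
apply: dimvS; apply/subvP=> f /memv_capP[fU]; rewrite memv_ker lfunE => /eqP r0.
have [g gV fE] := forms_divide PQ le_e (subvP UV _ fU) r0.
by apply/memv_imgP; exists g; rewrite ?lfunE //; apply: UW => //; rewrite -fE.
Qed.

End Dimensions.

(** * Contact with the tangent lines *)

Lemma dim_cap_preim (K : fieldType) (X Y : vectType K) (f : 'Hom(X, Y))
    (U : {vspace X}) (W W' : {vspace Y}) :
  (f @: U <= W)%VS -> (W' <= W)%VS ->
  (\dim U + \dim W' <= \dim (U :&: f @^-1: W')%VS + \dim W)%N.
Proof.
move=> fUW W'W; set Z := (U :&: _)%VS.
rewrite -(limg_ker_dim f U) -(limg_ker_dim f Z).
have -> : (Z :&: lker f)%VS = (U :&: lker f)%VS.
  apply/vspaceP=> x; rewrite !memv_cap -memv_preim memv_ker.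
  by case: eqP => [->|]; rewrite ?mem0v ?andbT ?andbF.
have -> : (f @: Z)%VS = (f @: U :&: W')%VS.
  apply/vspaceP=> y; rewrite memv_cap; apply/memv_imgP/andP.
    case=> x; rewrite memv_cap -memv_preim => /andP[xU fx] ->; split=> //.
    exact: memv_img.
  case=> /memv_imgP[x xU ->] fx; exists x => //.
  by rewrite memv_cap -memv_preim xU.
rewrite -!addnA leq_add2l -dimv_sum_cap addnC leq_add2l; apply: dimvS.
by rewrite subv_add fUW.
Qed.

Section Contact.
Variable F : finFieldType.
Notation fun3 := {ffun 'rV[F]_3 -> F^o}.
Notation fun1 := {ffun F -> F^o}.
Implicit Types (P Q R u v : 'rV[F]_3) (f g : fun3) (p h G : {poly F}).

(** Vanishing to order [a] at [P] along the line [PQ]. For [a > e + 1] the truncated subtraction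
    leaves only the zero restriction, as it should in degree [e]. *)
Definition contact P Q a e : {vspace fun3} :=
  (linfun (restr P Q) @^-1: polyspace 'X^a (e.+1 - a))%VS.

Lemma contactE P Q a e f p : (e < #|F|)%N -> (size p <= e.+1)%N ->
  (forall t, f (P + t *: Q) = p.[t]) -> (f \in contact P Q a e) = ('X^a %| p).
Proof.
move=> le_e sp pE; rewrite /contact -memv_preim lfunE /=; apply/polyspaceP/idP.
  case=> p' sp' e1; suff -> : p = 'X^a * p' by apply: dvdp_mulr.
  apply: poly_fun_inj; first exact: leq_trans sp _.
    have [->|p0] := eqVneq p' 0; first by rewrite mulr0 size_poly0.
    rewrite size_monicM ?monicXn // size_polyXn /=; apply: leq_trans le_e.
    have : (0 < size p')%N by rewrite size_poly_gt0.
    by move: (size p') sp'=> s; lia.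
  by move=> t; rewrite hornerM -e1 ffunE pE.
case/dvdpP=> p' e1; exists p'; last by move=> t; rewrite ffunE pE e1 hornerM mulrC.
have [->|p0] := eqVneq p' 0; first by rewrite size_poly0.
move: sp; rewrite e1 size_Mmonic ?monicXn // size_polyXn addnS /=.
by move: (size p')=> s; lia.
Qed.

(** On the line [PQ] the factor [l] becomes [l P + t l Q]: coprime to [t] if [l P != 0], and
    otherwise a nonzero multiple of [t], which accounts for one order of contact. *)
Lemma contact_mulfun l P Q a e g : linform l -> (l P = 0 -> l Q != 0) -> (e.+1 < #|F|)%N ->
  g \in forms F e -> mulfun l g \in contact P Q a e.+1 ->
  g \in contact P Q (a - (l P == 0)%R) e.
Proof.
move=> ll lPQ le_e gV; have [p sp pE] := forms_line_poly P Q gV.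
have s2 : (size ((l P)%:P + l Q *: 'X)%R <= 2)%N.
  apply: leq_trans (size_polyD _ _) _; rewrite geq_max size_polyC.
  by rewrite (leq_trans (size_scale_leq _ _)) ?size_polyX // andbT; case: (_ == 0).
have s3 : (size (((l P)%:P + l Q *: 'X) * p)%R <= e.+2)%N.
  by apply: leq_trans (size_polyMleq _ _) _; move: (size _) (size _) s2 sp => s1 s3; lia.
have e3 t : mulfun l g (P + t *: Q) = (((l P)%:P + l Q *: 'X) * p).[t].
  by rewrite ffunE pE addrC ll !hornerE; ring.
rewrite (contactE a le_e s3 e3).
rewrite (@contactE _ _ _ _ _ p) ?(ltnW le_e) //.
have [lP0|lP0] := eqVneq (l P) 0; rewrite ?subn0; last first.
  rewrite Gauss_dvdpr // coprimep_expl // coprimep_sym coprimepX.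
  by rewrite /root !hornerE.
case: a => [|a]; first by rewrite sub0n expr0 !dvd1p.
rewrite lP0 add0r (_ : _ - _ = a)%N ?subn1 // -scalerAl dvdpZr ?lPQ // exprS dvdp_mul2l ?polyX_eq0 //.
Qed.

Lemma contact_mulfun_unit l P Q a e g : linform l -> l P != 0 -> (e.+1 < #|F|)%N ->
  g \in forms F e -> mulfun l g \in contact P Q a e.+1 -> g \in contact P Q a e.
Proof.
move=> ll lP le_e gV /(contact_mulfun ll _ le_e gV); rewrite (negPf lP) subn0; apply.
by move=> lP0; rewrite lP0 eqxx in lP.
Qed.

Lemma contact_codim (U : {vspace fun3}) P Q a e : independent P Q ->
  (a <= e.+1)%N -> (e < #|F|)%N ->
  (U <= forms F e)%VS -> (\dim U <= \dim (U :&: contact P Q a e)%VS + a)%N.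
Proof.
move=> PQ ae le_e UV.
have fU : (linfun (restr P Q) @: U <= polyspace 1 e.+1)%VS by rewrite -(restr_forms e PQ) limgS.
have ss : (polyspace 'X^a (e.+1 - a) <= polyspace (1 : {poly F}) e.+1)%VS.
  apply/subvP=> f /polyspaceP[p sp fE]; apply/polyspaceP; exists ('X^a * p).
    have [->|p0] := eqVneq p 0; first by rewrite mulr0 size_poly0.
    by rewrite size_monicM ?monicXn // size_polyXn /=; move: (size p) sp => s; lia.
  by move=> t; rewrite hornerC mul1r hornerM.
have := dim_cap_preim fU ss; rewrite !dim_polyspace ?oner_eq0 // ?size_poly1 // ?monic_neq0
  ?monicXn //.
  by rewrite /contact; move: (\dim _) (\dim _) => s1 s2; lia.
by rewrite size_polyXn; move: #|F| le_e; lia.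
Qed.

End Contact.

(** * Independence of the contact conditions at three points *)

Section ThreePoints.
Variable F : finFieldType.
Notation fun3 := {ffun 'rV[F]_3 -> F^o}.
Implicit Types (P Q : 'rV[F]_3).

Definition contact3 P1 Q1 P2 Q2 P3 Q3 a1 a2 a3 e : {vspace fun3} :=
  (forms F e :&: contact P1 Q1 a1 e :&: contact P2 Q2 a2 e :&: contact P3 Q3 a3 e)%VS.

Lemma contact3P P1 Q1 P2 Q2 P3 Q3 a1 a2 a3 e f :
  reflect [/\ f \in forms F e, f \in contact P1 Q1 a1 e, f \in contact P2 Q2 a2 e
    & f \in contact P3 Q3 a3 e] (f \in contact3 P1 Q1 P2 Q2 P3 Q3 a1 a2 a3 e).
Proof. by rewrite !memv_cap -!andbA; apply: and4P. Qed.

Lemma dim_contact3_ge P1 Q1 P2 Q2 P3 Q3 a1 a2 a3 e :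
  independent P1 Q1 -> independent P2 Q2 -> independent P3 Q3 ->
  (a1 <= e.+1)%N -> (a2 <= e.+1)%N -> (a3 <= e.+1)%N -> (e < #|F|)%N ->
  ('C(e.+2, 2) <= \dim (contact3 P1 Q1 P2 Q2 P3 Q3 a1 a2 a3 e) + (a1 + a2 + a3))%N.
Proof.
move=> i1 i2 i3 l1 l2 l3 le_e; rewrite -(dim_forms le_e).
have := contact_codim i1 l1 le_e (subvv _).
have := contact_codim i2 l2 le_e (capvSl (forms F e) (contact P1 Q1 a1 e)).
have s : (forms F e :&: contact P1 Q1 a1 e :&: contact P2 Q2 a2 e <= forms F e)%VS.
  by apply: subv_trans (capvSl _ _) (capvSl _ _).
have := contact_codim i3 l3 le_e s; rewrite -/(contact3 P1 Q1 P2 Q2 P3 Q3 a1 a2 a3 e).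
by move: (\dim _) (\dim _) (\dim _) (\dim _); lia.
Qed.

(** The degree drops with each division, so the three tangents carry [n.+4], [n.+3] and [n.+2]
    coefficients; hence the three bounds. Each tangent misses the later points, so the contact there
    survives the division. *)
Lemma dim_contact3_le_sorted P1 Q1 P2 Q2 P3 Q3 a1 a2 a3 n :
  det3 P2 P1 Q1 != 0 -> det3 P3 P1 Q1 != 0 -> det3 P3 P2 Q2 != 0 -> independent P3 Q3 ->
  (a1 <= n.+4)%N -> (a2 <= n.+3)%N -> (a3 <= n.+2)%N -> (n.+3 < #|F|)%N ->
  (\dim (contact3 P1 Q1 P2 Q2 P3 Q3 a1 a2 a3 n.+3) + (a1 + a2 + a3) <= 'C(n.+3.+2, 2))%N.
Proof.
move=> d21 d31 d32 i3 l1 l2 l3 le_n.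
have i1 : independent P1 Q1 by exists P2.
have i2 : independent P2 Q2 by exists P3.
pose U1 := (forms F n.+2 :&: contact P2 Q2 a2 n.+2 :&: contact P3 Q3 a3 n.+2)%VS.
pose U2 := (forms F n.+1 :&: contact P3 Q3 a3 n.+1)%VS.
have dimr (U : {vspace fun3}) P Q a e : (U <= contact P Q a e)%VS ->
    (\dim (linfun (restr P Q) @: U)%VS <= e.+1 - a)%N.
  move=> UC; apply: leq_trans (dim_polyspace_le 'X^a (e.+1 - a)); apply: dimvS.
  apply/subvP=> r /memv_imgP[f fU ->]; have := subvP UC _ fU.
  by rewrite -memv_preim.
have le1 : (n.+2 < #|F|)%N := ltnW le_n.
have le2 : (n.+1 < #|F|)%N := ltnW le1.
have ld P Q := @linform_det F P Q.
have s1 : (\dim (contact3 P1 Q1 P2 Q2 P3 Q3 a1 a2 a3 n.+3) <= n.+4 - a1 + \dim U1)%N.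
  apply: leq_trans (@dim_le_restr F _ U1 n.+2 P1 Q1 i1 le_n _ _) _.
  - by apply/subvP=> f /contact3P[].
  - move=> g gV /contact3P[_ _ c2 c3]; rewrite !memv_cap gV /=; apply/andP; split.
      exact: contact_mulfun_unit (ld P1 Q1) d21 le_n gV c2.
    exact: contact_mulfun_unit (ld P1 Q1) d31 le_n gV c3.
  by rewrite leq_add2r; apply: dimr; apply/subvP=> f /contact3P[].
have s2 : (\dim U1 <= n.+3 - a2 + \dim U2)%N.
  apply: leq_trans (@dim_le_restr F _ U2 n.+1 P2 Q2 i2 le1 _ _) _.
  - by apply: subv_trans (capvSl _ _) (capvSl _ _).
  - move=> g gV; rewrite !memv_cap gV => /andP[_ c3] /=.
    exact: contact_mulfun_unit (ld P2 Q2) d32 le1 gV c3.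
  by rewrite leq_add2r; apply: dimr; apply: subv_trans (capvSl _ _) (capvSr _ _).
have s3 : (\dim U2 <= n.+2 - a3 + \dim (forms F n))%N.
  apply: leq_trans (@dim_le_restr F _ (forms F n) n P3 Q3 i3 le2 _ _) _.
  - exact: capvSl.
  - by [].
  by rewrite leq_add2r; apply: dimr; apply: capvSr.
rewrite (dim_forms (ltnW le2)) in s3.
rewrite !(binS _.+2 1, binS _.+3 1, binS _.+4 1) !bin1; lia.
Qed.

(** Sort the multiplicities in decreasing order. A second one above [e] would give a pair with sum
    at least [2e + 2], and a third one above [e - 1] a total of at least [3e]. *)
Lemma dim_contact3_le P1 Q1 P2 Q2 P3 Q3 a1 a2 a3 e :
  det3 P2 P1 Q1 != 0 -> det3 P3 P1 Q1 != 0 -> det3 P1 P2 Q2 != 0 -> det3 P3 P2 Q2 != 0 ->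
  det3 P1 P3 Q3 != 0 -> det3 P2 P3 Q3 != 0 ->
  (2 < e < #|F|)%N -> (a1 <= e.+1)%N -> (a2 <= e.+1)%N -> (a3 <= e.+1)%N ->
  (a1 + a2 < e.*2.+2)%N -> (a1 + a3 < e.*2.+2)%N -> (a2 + a3 < e.*2.+2)%N ->
  (a1 + a2 + a3 < 3 * e)%N ->
  (\dim (contact3 P1 Q1 P2 Q2 P3 Q3 a1 a2 a3 e) + (a1 + a2 + a3) <= 'C(e.+2, 2))%N.
Proof.
move=> d21 d31 d12 d32 d13 d23 /andP[e2 le_e] l1 l2 l3 l12 l13 l23 l123.
case: e e2 le_e l1 l2 l3 l12 l13 l23 l123 => [|[|[|n]]] // _ le_e l1 l2 l3 l12 l13 l23 l123.
have i1 : independent P1 Q1 by exists P2.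
have i2 : independent P2 Q2 by exists P3.
have i3 : independent P3 Q3 by exists P2.
have c23 : contact3 P1 Q1 P2 Q2 P3 Q3 a1 a2 a3 n.+3 = contact3 P1 Q1 P3 Q3 P2 Q2 a1 a3 a2 n.+3.
  by apply/vspaceP=> f; rewrite !memv_cap -!andbA; do !bool_congr.
have c12 : contact3 P1 Q1 P2 Q2 P3 Q3 a1 a2 a3 n.+3 = contact3 P2 Q2 P1 Q1 P3 Q3 a2 a1 a3 n.+3.
  by apply/vspaceP=> f; rewrite !memv_cap -!andbA; do !bool_congr.
have c13 : contact3 P1 Q1 P2 Q2 P3 Q3 a1 a2 a3 n.+3 = contact3 P3 Q3 P2 Q2 P1 Q1 a3 a2 a1 n.+3.
  by apply/vspaceP=> f; rewrite !memv_cap -!andbA; do !bool_congr.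
have c231 : contact3 P1 Q1 P2 Q2 P3 Q3 a1 a2 a3 n.+3 = contact3 P2 Q2 P3 Q3 P1 Q1 a2 a3 a1 n.+3.
  by apply/vspaceP=> f; rewrite !memv_cap -!andbA; do !bool_congr.
have c312 : contact3 P1 Q1 P2 Q2 P3 Q3 a1 a2 a3 n.+3 = contact3 P3 Q3 P1 Q1 P2 Q2 a3 a1 a2 n.+3.
  by apply/vspaceP=> f; rewrite !memv_cap -!andbA; do !bool_congr.
have [a12|a12] := leqP a2 a1; have [a23|a23] := leqP a3 a2; have [a13|a13] := leqP a3 a1; try lia.
- by apply: dim_contact3_le_sorted => //; lia.
- by rewrite c23 (_ : a1 + a2 + a3 = a1 + a3 + a2)%N; [apply: dim_contact3_le_sorted => //|]; lia.
- by rewrite c312 (_ : a1 + a2 + a3 = a3 + a1 + a2)%N; [apply: dim_contact3_le_sorted => //|]; lia.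
- by rewrite c12 (_ : a1 + a2 + a3 = a2 + a1 + a3)%N; [apply: dim_contact3_le_sorted => //|]; lia.
- by rewrite c231 (_ : a1 + a2 + a3 = a2 + a3 + a1)%N; [apply: dim_contact3_le_sorted => //|]; lia.
- by rewrite c13 (_ : a1 + a2 + a3 = a3 + a2 + a1)%N; [apply: dim_contact3_le_sorted => //|]; lia.
Qed.

End ThreePoints.

(** * Congruence modulo a power of the parameter *)

Section CongruenceModPower.
Variables (F : fieldType) (a : nat).
Implicit Types x y z : {poly F}.

Definition eqmodX x y := 'X^a %| x - y.

Lemma eqmodXx x : eqmodX x x.
Proof. by rewrite /eqmodX subrr dvdp0. Qed.

Lemma eqmodX_dvd x y : eqmodX x y -> ('X^a %| x) = ('X^a %| y).
Proof. by move=> xy; rewrite -{1}(subrK y x) dvdp_addr. Qed.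

Lemma eqmodXD x x' y y' : eqmodX x x' -> eqmodX y y' -> eqmodX (x + y) (x' + y').
Proof. by move=> ex ey; rewrite /eqmodX opprD addrACA; apply: dvdp_add. Qed.

Lemma eqmodXN x x' : eqmodX x x' -> eqmodX (- x) (- x').
Proof. by rewrite /eqmodX -opprD dvdpNr. Qed.

Lemma eqmodXM x x' y y' : eqmodX x x' -> eqmodX y y' -> eqmodX (x * y) (x' * y').
Proof.
move=> ex ey; rewrite /eqmodX (_ : _ - _ = (x - x') * y + x' * (y - y')); last by ring.
by apply: dvdp_add; [apply: dvdp_mulr|apply: dvdp_mull].
Qed.

Lemma eqmodXX x x' n : eqmodX x x' -> eqmodX (x ^+ n) (x' ^+ n).
Proof. by move=> ex; elim: n => [|n IH]; rewrite ?expr0 ?eqmodXx // !exprS eqmodXM. Qed.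

Lemma eqmodX_horner0 x y : (0 < a)%N -> eqmodX x y -> x.[0] = y.[0].
Proof.
move=> a0 xy; apply/eqP; rewrite -subr_eq0 -hornerN -hornerD -[_ == 0]/(root _ 0) -dvdp_XsubCl subr0.
by apply: dvdp_trans xy; rewrite dvdp_exp.
Qed.

Lemma eqmodX_form_eval d (c : 'I_d.+1 -> 'I_d.+1 -> {poly F}) x x' y y' z z' :
  eqmodX x x' -> eqmodX y y' -> eqmodX z z' ->
  eqmodX (form_eval c x y z) (form_eval c x' y' z').
Proof.
move=> ex ey ez; rewrite /form_eval.
elim/big_ind2: _ => [||i _]; [exact: eqmodXx|by move=> *; apply: eqmodXD|].
elim/big_ind2: _ => [||j _]; [exact: eqmodXx|by move=> *; apply: eqmodXD|].
by do !apply: eqmodXM => //; rewrite ?eqmodXx ?eqmodXX.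
Qed.

Lemma eqmodX_herm q x x' y y' z z' :
  eqmodX x x' -> eqmodX y y' -> eqmodX z z' -> eqmodX (herm q x y z) (herm q x' y' z').
Proof.
move=> ex ey ez; rewrite /herm.
by rewrite !(eqmodXD, eqmodXN, eqmodXM, eqmodXX).
Qed.

End CongruenceModPower.

(** * From germs on the curve to contact with the tangent *)

Section VanishingScheme.
Variables (F : finFieldType) (q : nat).
Hypothesis hq : exists p m : nat, [/\ prime p, (0 < m)%N & q = (p ^ m)%N].
Hypothesis hF : #|F| = (q ^ 2)%N.
Implicit Types (P Q R v : 'rV[F]_3) (x y z : {poly F}).

Lemma frobB_poly x y : (x - y) ^+ q = x ^+ q - y ^+ q.
Proof.
apply/eqP; rewrite eq_sym subr_eq -exprDn_pchar ?subrK //.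
case: hq => p [m [pp m0 eq_q]].
have pF : p \in [pchar {poly F}].
  by rewrite pchar_poly; apply: (@card_finPcharP _ p (m * 2)) => //; rewrite hF eq_q -expnM.
by rewrite eq_q pnatX (eq_pnat _ (pcharf_eq pF)) pnat_id.
Qed.

(** In characteristic [p] the difference is the [q]-th power of [x - x(0)], which is divisible by
    ['X]. *)
Lemma frob_eqmodX a x : (a <= q)%N -> eqmodX a (x ^+ q) ((x.[0] ^+ q)%:P).
Proof.
move=> aq; rewrite /eqmodX polyC_exp -frobB_poly.
apply: (dvdp_trans (dvdp_exp2l _ aq)); apply: dvdp_exp2r.
by rewrite -[X in X %| _]subr0 dvdp_XsubCl /root !hornerE subrr.
Qed.

(** The value of [l] at a polynomial triple, taken through its coefficients because [l] is defined
    only over [F]. *)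
Definition linpoly (l : 'rV[F]_3 -> F) x y z : {poly F} :=
  l (row3 1 0 0) *: x + l (row3 0 1 0) *: y + l (row3 0 0 1) *: z.

Lemma linpolyE l x y z t : linform l ->
  (linpoly l x y z).[t] = l (row3 x.[t] y.[t] z.[t]).
Proof. by move=> ll; rewrite [RHS](linformE ll) !coordE /linpoly !hornerE. Qed.

Lemma size_linpoly l x y z m : (size x <= m)%N -> (size y <= m)%N -> (size z <= m)%N ->
  (size (linpoly l x y z) <= m)%N.
Proof.
move=> sx sy sz; rewrite /linpoly !(leq_trans (size_polyD _ _)) // geq_max.
rewrite !(leq_trans (size_scale_leq _ _)) // andbT.
rewrite !(leq_trans (size_polyD _ _)) // geq_max.
by rewrite !(leq_trans (size_scale_leq _ _)).
Qed.

(* Up to order q, hence up to order a, the Frobenius of a germ is constant, so that the equation of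
   the curve coincides with that of its tangent. *)
Lemma herm_eqmodX a x y z P : (a <= q)%N -> x.[0] = cx P -> y.[0] = cy P -> z.[0] = cz P ->
  eqmodX a (herm q x y z) (linpoly (fun v => hform q v P) x y z).
Proof.
move=> aq ex ey ez.
have := frob_eqmodX x aq; have := frob_eqmodX y aq; have := frob_eqmodX z aq.
rewrite ex ey ez => fz fy fx.
have -> : linpoly (fun v => hform q v P) x y z =
    y * (cz P ^+ q)%:P + (cy P ^+ q)%:P * z - x * (cx P ^+ q)%:P.
  rewrite /linpoly /hform !coordE -!mul_polyC !(mul0r, mul1r, sub0r, addr0, add0r, subr0) polyCN.
  by ring.
by rewrite /herm exprS !(eqmodXD, eqmodXN, eqmodXM, eqmodXx).
Qed.

Lemma size_jet a (G : 'M[F]_(3, a)) r : (size (jet G r) <= a)%N.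
Proof.
apply: leq_trans (size_sum _ _ _) _; apply/bigmax_leqP => k _.
by apply: leq_trans (size_scale_leq _ _) _; rewrite size_polyXn.
Qed.

Lemma jet_eqmodX a (x : 'I_3 -> {poly F}) r :
  eqmodX a (jet (\matrix_(i < 3, k < a) (x i)`_k) r) (x r).
Proof.
have -> : jet (\matrix_(i < 3, k < a) (x i)`_k) r = take_poly a (x r).
  by rewrite /take_poly poly_def; apply: eq_bigr => k _; rewrite mxE.
by rewrite /eqmodX -{2}(poly_take_drop a (x r)) opprD addNKr dvdpNr dvdp_mull.
Qed.

(** In one direction the parametrized tangent [P + t Q] is itself an admissible germ. In the other,
    every germ on the curve is congruent to [u P + s Q] with [s(0) = 0], and the form becomes a
    binary form in [u] and [s]. *)
Lemma vanishes_contact d a (M : 'M[F]_(d.+1, d.+1)) P Q c :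
  P \in hermPts F q -> c != 0 -> (forall v, det3 v P Q = c * hform q v P) ->
  (0 < a <= d)%N -> (d < q)%N ->
  vanishes_on_multiple q a M P = (feval M \in contact P Q a d).
Proof.
move=> Ph c0 cE /andP[a0 ad] dq.
have aq : (a <= q)%N by lia.
have dF : (d < #|F|)%N by rewrite hF; apply: leq_trans dq _; rewrite leq_pmulr //; lia.
have hPP : hform q P P = 0 by move: Ph; rewrite hermPtsE => /andP[_ /eqP].
have hQP : hform q Q P = 0.
  by apply: (mulfI c0); rewrite -cE mulr0 /det3; ring.
have PQ : independent P Q.
  have := normalized_neq0 (_ : normalized P); rewrite hermPtsE in Ph;
    case/andP: Ph => nP _ /(_ nP) P0.
  have [R hR] : exists R, hform q R P != 0.
    case: (pickP (fun R => hform q R P != 0)) => [R|h]; first by exists R.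
    by case/eqP: P0; apply: (@hform_nondegenerate F q) => v; move/eqP: (negbFE (h v)).
  by exists R; rewrite cE mulf_neq0.
apply/idP/idP.
  move/forallP=> van; rewrite (@contactE _ _ _ _ _ _ (line_poly M P Q)) ?size_line_poly //;
    last first.
    by move=> t; rewrite line_polyE.
  pose x (r : 'I_3) : {poly F} := (P ord0 r)%:P + Q ord0 r *: 'X.
  have x0 r : (x r).[0] = P ord0 r by rewrite /x !hornerE.
  have jx r := jet_eqmodX a x r.
  have := van (\matrix_(i < 3, k < a) (x i)`_k); cbv zeta.
  rewrite !(eqmodX_horner0 a0 (jx _)) !x0 !eqxx /=.
  rewrite (eqmodX_dvd (eqmodX_herm q (jx _) (jx _) (jx _))).
  rewrite (eqmodX_dvd (herm_eqmodX aq (x0 _) (x0 _) (x0 _))).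
  rewrite (eqmodX_dvd (eqmodX_form_eval _ (jx _) (jx _) (jx _))).
  suff -> : linpoly (fun v => hform q v P) (x (@Ordinal 3 0 isT)) (x (@Ordinal 3 1 isT))
     (x (@Ordinal 3 2 isT)) = 0 by rewrite dvdp0.
  have s2 r : (size (x r) <= #|F|)%N.
    apply: leq_trans (size_polyD _ _) _; rewrite geq_max size_polyC.
    rewrite (leq_trans (size_scale_leq _ _)) ?size_polyX; last by lia.
    by rewrite andbT; case: (_ == 0); lia.
  apply: poly_fun_inj; rewrite ?size_poly0 ?size_linpoly // => t.
  rewrite linpolyE; last exact: linform_hform.
  rewrite horner0 (_ : row3 _ _ _ = P + t *: Q); last first.
    by apply: row3P; rewrite !coordE !hornerE mulrC.
  by rewrite hformD hformZ hPP hQP mulr0 addr0.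
move=> con; apply/forallP=> G; cbv zeta.
set gx := jet G _; set gy := jet G _; set gz := jet G _.
apply/implyP=> /and3P[/eqP gx0 /eqP gy0 /eqP gz0]; apply/implyP=> hG.
have {}hG : 'X^a %| linpoly (fun v => hform q v P) gx gy gz.
  by rewrite -(eqmodX_dvd (herm_eqmodX aq gx0 gy0 gz0)).
have [h sh hE] := independent_binform PQ (introT (formsP _ _) (ex_intro _ M erefl)).
have [R D0] := PQ; set D := det3 R P Q in D0.
pose lu v := det3 R v Q / D; pose ls v := det3 R P v / D.
have llu : linform lu by move=> b u v; rewrite /lu /det3 !coordE; ring.
have lls : linform ls by move=> b u v; rewrite /ls /det3 !coordE; ring.
pose w := linpoly (fun v => det3 v P Q) gx gy gz.
pose u := linpoly lu gx gy gz; pose s := linpoly ls gx gy gz.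
have sa l : (size (linpoly l gx gy gz) <= a)%N by rewrite size_linpoly ?size_jet.
have aF : (a <= #|F|)%N by lia.
(* The component [w] of the germ outside the tangent is [c] times the equation of the tangent, hence
   vanishes modulo [t^a]. *)
have wa : 'X^a %| w.
  have -> : w = c *: linpoly (fun v => hform q v P) gx gy gz.
    by rewrite /w /linpoly !cE !scalerDr !scalerA.
  by rewrite dvdpZr.
have s0 : s.[0] = 0.
  by rewrite linpolyE // gx0 gy0 gz0 -row3E /ls (_ : det3 _ _ _ = 0) ?mul0r // /det3; ring.
have gE (l : 'rV[F]_3 -> F) : linform l -> eqmodX a (linpoly l gx gy gz) (l P *: u + l Q *: s).
  move=> ll; suff -> : linpoly l gx gy gz = (l R / D) *: w + (l P *: u + l Q *: s).
    by rewrite /eqmodX addrK -mul_polyC dvdp_mull.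
  apply: poly_fun_inj; first exact: leq_trans (sa _) aF.
    have sc (b : F) l' := leq_trans (size_scale_leq b _) (sa l').
    apply: leq_trans aF; apply: leq_trans (size_polyD _ _) _; rewrite geq_max sc /=.
    by apply: leq_trans (size_polyD _ _) _; rewrite geq_max !sc.
  move=> t; rewrite linpolyE // [RHS]hornerD [X in _ = _ + X]hornerD !hornerZ.
  rewrite (linpolyE _ _ _ _ llu) (linpolyE _ _ _ _ lls) (linpolyE _ _ _ _ (@linform_det F P Q)).
  apply: (mulfI D0); rewrite [LHS](linform_cramer _ _ _ _ ll) -/D /lu /ls.
  by field.
have ecx : linpoly (@cx F) gx gy gz = gx.
  by rewrite /linpoly !coordE scale1r !scale0r !addr0.
have ecy : linpoly (@cy F) gx gy gz = gy.
  by rewrite /linpoly !coordE scale1r !scale0r addr0 add0r.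
have ecz : linpoly (@cz F) gx gy gz = gz.
  by rewrite /linpoly !coordE scale1r !scale0r !add0r.
have lx : linform (@cx F) by move=> b v v'; rewrite !coordE.
have ly : linform (@cy F) by move=> b v v'; rewrite !coordE.
have lz : linform (@cz F) by move=> b v v'; rewrite !coordE.
have ex := gE _ lx; have ey := gE _ ly; have ez := gE _ lz; rewrite ecx in ex; rewrite ecy in ey;
  rewrite ecz in ez.
rewrite (eqmodX_dvd (eqmodX_form_eval _ ex ey ez)).
have hE' : form_eval (fun i j => (M i j)%:P) (cx P *: u + cx Q *: s) (cy P *: u + cy Q *: s)
    (cz P *: u + cz Q *: s) = \sum_(k < d.+1) h`_k *: (u ^+ (d - k) * s ^+ k).
  (* The germ has degree at most [a - 1], so both sides have degree at most [d (a - 1) < q^2] and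
     are determined by their values. *)
  have dF' : ((d * a.-1).+1 <= #|F|)%N by rewrite hF expnS expn1; move: ad dq; clear; nia.
  have aS : (a <= a.-1.+1)%N by clear; lia.
  have sus (b b' : F) : (size (b *: u + b' *: s)%R <= a.-1.+1)%N.
    apply: leq_trans aS; apply: leq_trans (size_polyD _ _) _; rewrite geq_max.
    by apply/andP; split; apply: leq_trans (size_scale_leq _ _) (sa _).
  apply: poly_fun_inj.
  - by apply: leq_trans dF'; apply: (@size_form_eval _ _ _ (fun i j => M i j)).
  - apply: leq_trans dF'; apply: leq_trans (size_sum _ _ _) _; apply/bigmax_leqP => k _.
    apply: leq_trans (size_scale_leq _ _) _; apply: leq_trans (size_polyMleq _ _) _.
    have su := size_exp_mul_leq (d - k)%N (leq_trans (sa lu) aS : (size u <= _)%N).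
    have ss := size_exp_mul_leq k (leq_trans (sa ls) aS : (size s <= _)%N).
    have e1 : ((d - k) * a.-1 + k * a.-1 = d * a.-1)%N.
      by rewrite -mulnDl subnK // -ltnS.
    move: (size _) (size _) su ss e1 => s1 s2.
    by move: ((d - k) * a.-1)%N (k * a.-1)%N (d * a.-1)%N; clear; lia.
  move=> t; rewrite (form_eval_horner (fun i j => M i j)) horner_sum.
  have eus (b b' : F) : (b *: u + b' *: s).[t] = u.[t] * b + s.[t] * b'.
    by rewrite hornerD !hornerZ mulrC [b' * _]mulrC.
  have := hE u.[t] s.[t]; rewrite ffunE !coordE !eus => ->.
  by apply: eq_bigr => k _; rewrite hornerZ hornerM !horner_exp mulrA.
rewrite hE'.
have dvh : 'X^a %| h.
  rewrite -(@contactE _ P Q a d (feval M)) // => t.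
  by have := hE 1 t; rewrite scale1r binform1.
have Xs : 'X %| s by rewrite -[X in X %| _]subr0 dvdp_XsubCl /root s0.
(* Terms with [k < a] vanish since [h] is divisible by ['X^a], the others are divisible by [s^k],
   hence by ['X^a]. *)
elim/big_ind: _ => [|x y|k _]; [exact: dvdp0|exact: dvdp_add|].
have [ka|ka] := ltnP k a.
  by case/dvdpP: dvh => h' ->; rewrite coefMXn ka scale0r dvdp0.
rewrite -mul_polyC; do 2!apply: dvdp_mull.
by apply: dvdp_trans (dvdp_exp2l _ ka) _; apply: dvdp_exp2r.
Qed.

End VanishingScheme.

(** * Separation of points *)

Section LineProducts.
Variable F : finFieldType.
Notation fun3 := {ffun 'rV[F]_3 -> F^o}.
Implicit Types (s x y v : 'rV[F]_3) (S T : {set 'rV[F]_3}).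

Definition separated n s T :=
  exists g : fun3, [/\ g \in forms F n, g s != 0 & {in T, forall x, g x = 0}].

Lemma separated_line n s T l : linform l -> l s != 0 ->
  separated n s [set x in T | l x != 0] -> separated n.+1 s T.
Proof.
move=> ll ls [g [gV gs gT]]; exists (mulfun l g); split.
- exact: mulfun_forms.
- by rewrite ffunE mulf_neq0.
move=> x xT; rewrite ffunE; have [->|lx] := eqVneq (l x) 0; first by rewrite mul0r.
by rewrite gT ?mulr0 // inE xT.
Qed.

Lemma separated_points n s T : normalized s -> {in T, forall x, normalized x} -> s \notin T ->
  (#|T| <= n)%N -> separated n s T.
Proof.
elim: n T => [|n IH] T ns nT sT.
  rewrite leqn0 cards_eq0 => /eqP->; exists (mono F 0 0 0); split; first exact: (mono_forms F 0 0 0).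
    by rewrite ffunE !expr0 !mulr1 oner_eq0.
  by move=> x; rewrite inE.
(* The degree must be exactly [n]: once [T] is exhausted, a dummy point different from [s] supplies
   the remaining lines. *)
move=> cT; have [x xs hx] : exists2 x, normalized x && (x != s) & (T != set0 -> x \in T).
  have [->|[x xT]] := set_0Vmem T.
    have [ns'|ns'] := eqVneq s (row3 1 0 0).
      exists (row3 0 1 0); last by rewrite eqxx.
      rewrite normalized_row3 !coordE !eqxx orbT ns' /=; apply/eqP=> /(congr1 (@cx F)).
      by rewrite !coordE => /esym/eqP; rewrite oner_eq0.
    by exists (row3 1 0 0); [rewrite normalized_row3 !coordE eqxx /= eq_sym|rewrite eqxx].
  by exists x => //; rewrite nT //=; apply: contraNneq sT => <-.
case/andP: xs => nx xs; have [R D0] := normalized_free nx ns xs.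
have ll : linform (fun v => det3 R x v) by move=> a u v; rewrite /det3 !coordE; ring.
apply: (separated_line ll D0); apply: IH => //.
- by move=> y; rewrite inE => /andP[/nT].
- by rewrite inE negb_and sT.
have [T0|/hx xT] := eqVneq T set0.
  by rewrite (_ : [set _ in _ | _] = set0) ?cards0 //; apply/setP=> y; rewrite T0 !inE.
rewrite -ltnS; apply: leq_trans cT; apply: proper_card; apply/properP; split.
  by apply/subsetP=> y; rewrite inE => /andP[].
by exists x => //; rewrite inE xT /= negbK; apply/eqP; rewrite /det3; ring.
Qed.

(* With n = d - 3: three collinear points, or two disjoint pairs when there are none, save two lines
   over separating the points one at a time. *)
Lemma separated_or_collinear n S : (1 < n)%N -> S != set0 -> {in S, forall x, normalized x} ->
  (#|S| <= n.+3)%N ->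
  (exists2 s, s \in S & separated n s (S :\ s)) \/
  (n.+1 < #|S|)%N /\ (exists x y, [/\ x \in S, y \in S, x != y & {in S, forall z, det3 z x y = 0}]).
Proof.
move=> n1 /set0Pn[s sS] nS cS.
have nD s' : {in S :\ s', forall x, normalized x} by move=> x /setD1P[_ /nS].
have [cS1|cS1] := leqP #|S| n.+1.
  left; exists s => //; apply: separated_points; rewrite ?nS ?setD11 //.
  by move: cS1; rewrite (cardsD1 s) sS.
have l2 x y : linform (fun v => det3 v x y) := @linform_det F x y.
pose col (p : 'rV[F]_3 * 'rV[F]_3 * 'rV[F]_3) :=
  [&& p.1.1 \in S, p.1.2 \in S, p.2 \in S, p.1.1 != p.1.2, p.2 != p.1.1, p.2 != p.1.2 & det3 p.2
    p.1.1 p.1.2 == 0].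
have [[[x y] z] /and5P[/= xS yS zS xy /and3P[zx zy /eqP dz]]|nocol] := pickP col.
  have [/existsP[t /andP[tS dt]]|] := boolP [exists t, (t \in S) && (det3 t x y != 0)]; last first.
    rewrite negb_exists => /forallP h; right; split=> //; exists x, y; split=> // t tS.
    by have := h t; rewrite tS negbK => /eqP.
  left; exists t => //; case: n n1 cS cS1 => // n n1 cS cS1.
  apply: (separated_line (l2 x y) dt); apply: separated_points; rewrite ?nS //.
  - by move=> u; rewrite !inE => /andP[/andP[_ /nS]].
  - by rewrite !inE eqxx.
  have dx : det3 x x y = 0 by rewrite /det3; ring.
  have dy : det3 y x y = 0 by rewrite /det3; ring.
  have sub : [set u in S :\ t | det3 u x y != 0] \subset S :\ t :\ x :\ y :\ z.
    apply/subsetP=> u; rewrite !inE => /andP[/andP[-> ->] du]; rewrite !andbT.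
    by apply/and3P; split; apply: contraNneq du => ->; rewrite ?dx ?dy ?dz.
  have nt u : det3 u x y = 0 -> u != t by move=> du; apply: contraNneq dt => <-; rewrite du.
  apply: leq_trans (subset_leq_card sub) _.
  have := cardsD1 t S; rewrite tS; have := cardsD1 x (S :\ t); rewrite !inE xS nt //.
  have := cardsD1 y (S :\ t :\ x); rewrite !inE yS nt // eq_sym xy.
  have := cardsD1 z (S :\ t :\ x :\ y); rewrite !inE zS nt // zx zy /=.
  by move: cS; move: #|_| #|_| #|_| #|_| #|_|; clear; lia.
(* From here on no three points of [S] are collinear, so a line through two others misses [s]. *)
left; exists s => //.
have dneq x y z : x \in S -> y \in S -> z \in S -> x != y -> z != x -> z != y -> det3 z x y != 0.
  move=> xS yS zS xy zx zy; have := nocol (x, y, z); rewrite /col /= xS yS zS xy zx zy /=.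
  by move/negbT.
have by_pair m T : (T \subset S :\ s) -> (1 < #|T|)%N -> (forall T', T' \subset S :\ s -> (#|T'|.+2
  <= #|T|)%N ->
    separated m s T') -> separated m.+1 s T.
  move=> TS /card_gt1P[x [y [xT yT xy]]] H.
  have /setD1P[xs xS] := subsetP TS _ xT; have /setD1P[ys yS] := subsetP TS _ yT.
  have ds : det3 s x y != 0 by apply: dneq => //; rewrite eq_sym.
  apply: (separated_line (l2 x y) ds); apply: H.
    by apply: subset_trans TS; apply/subsetP=> u; rewrite inE => /andP[].
  have sub : [set u in T | det3 u x y != 0] \subset T :\ x :\ y.
    apply/subsetP=> u; rewrite !inE => /andP[-> du]; rewrite andbT.
    by apply/andP; split; apply: contraNneq du => ->; rewrite /det3; apply/eqP; ring.
  have := subset_leq_card sub; have := cardsD1 x T; rewrite xT; have := cardsD1 y (T :\ x).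
  rewrite !inE yT eq_sym xy /=.
  by move: #|_| #|_| #|_| #|_|; clear; lia.
have pts m T : T \subset S :\ s -> (#|T| <= m)%N -> separated m s T.
  move=> TS; apply: separated_points; rewrite ?nS //.
    by move=> x /(subsetP TS) /nD.
  by apply/negP=> /(subsetP TS); rewrite setD11.
have cSs : #|S| = #|S :\ s|.+1 by rewrite (cardsD1 s) sS.
case: n n1 cS cS1 => // n n1 cS cS1; apply: (by_pair) => //; first by move: #|_| #|_| cSs cS cS1; lia.
move=> T TS cT; have [cTn|cTn] := leqP #|T| n; first exact: pts.
case: n n1 cS cS1 cTn => // n n1 cS cS1 cTn; apply: (by_pair) => //; first by lia.
by move=> T' TS' cT'; apply: pts => //; move: #|T'| #|T| #|_| #|_| cT' cT cSs cS; lia.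
Qed.

End LineProducts.

(** * The affine parameter on the line through two points *)

Section LineParameter.
Variable F : finFieldType.
Implicit Types (s x y v u w : 'rV[F]_3) (h : {poly F}).

Lemma binform_scale e h b t : (size h <= e.+1)%N -> binform e h b (b * t) = b ^+ e * h.[t].
Proof.
move=> sh; rewrite -(binform1 t sh) /binform mulr_sumr; apply: eq_bigr => k _.
rewrite expr1n mulr1 exprMn; have -> : b ^+ e = b ^+ (e - k) * b ^+ k.
  by rewrite -exprD subnK // -ltnS.
by ring.
Qed.

Lemma binform01 e h : binform e h 0 1 = h`_e.
Proof.
rewrite /binform big_ord_recr /= subnn expr0 expr1n !mulr1 big1 ?add0r // => k _.
by rewrite expr0n subn_eq0 leqNgt ltn_ord mulr0 mul0r.
Qed.

(** The kernel of a nonzero linear form is a plane. Applied to the line of a support, this shows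
    that it does not contain all three [P_i] and that it is the line of any two [P_i] on it. *)
Lemma linform_det3_eq0 l R u v w : linform l -> l R != 0 -> l u = 0 -> l v = 0 -> l w = 0 ->
  det3 u v w = 0.
Proof.
move=> ll lR lu lv lw; have := linform_cramer u v w R ll.
by rewrite lu lv lw !mulr0 !addr0 => /eqP; rewrite mulf_eq0 (negPf lR) orbF => /eqP.
Qed.

Variables (R s s' : 'rV[F]_3).
Hypothesis D0 : det3 R s s' != 0.
Hypothesis ns' : normalized s'.

(** The [t] for which [v] is proportional to [s + t *: s']. The point [s'] is at infinity, where the
    division by zero returns [0]; hence the condition [v != s'] below. *)
Definition line_param v := det3 R s v / det3 R v s'.

Lemma line_coord_neq0 v : normalized v -> v != s' -> det3 v s s' = 0 -> det3 R v s' != 0.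
Proof.
move=> nv vs lv; apply/eqP=> e0; have [R' d0] := normalized_free nv ns' vs.
have := cramer3 R s s' v; rewrite lv e0 !scale0r !add0r => e1.
case/eqP: (mulf_neq0 D0 d0).
have -> : det3 R s s' * det3 R' v s' = det3 R' (det3 R s s' *: v) s' by rewrite /det3 !coordE; ring.
by rewrite e1 /det3 !coordE; ring.
Qed.

Lemma line_paramE v : det3 v s s' = 0 -> det3 R v s' != 0 ->
  v = (det3 R v s' / det3 R s s') *: s + (det3 R v s' / det3 R s s' * line_param v) *: s'.
Proof.
move=> lv d0; have := cramer3 R s s' v; rewrite lv scale0r add0r => e1.
apply: (scalerI D0); rewrite e1 scalerDr !scalerA /line_param.
by congr (_ *: _ + _ *: _); field; rewrite ?D0 ?d0.
Qed.

Lemma line_param_inj v w : normalized v -> normalized w -> v != s' -> w != s' ->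
  det3 v s s' = 0 -> det3 w s s' = 0 -> line_param v = line_param w -> v = w.
Proof.
move=> nv nw vs ws lv lw e; apply/eqP/negPn/negP=> vw; have [R' /eqP] := normalized_free nv nw vw;
  apply.
rewrite (line_paramE lv (line_coord_neq0 nv vs lv)) (line_paramE lw (line_coord_neq0 nw ws lw)) e.
by rewrite /det3 !coordE; ring.
Qed.

Lemma line_param_neq0 v : normalized s -> normalized v -> v != s -> v != s' ->
  det3 v s s' = 0 -> line_param v != 0.
Proof.
move=> ns nv vs vs' lv; have d0 := line_coord_neq0 nv vs' lv.
rewrite mulf_neq0 ?invr_eq0 //; apply/eqP=> e0.
have [R' /eqP] := normalized_free nv ns vs; apply.
rewrite (line_paramE lv d0) /line_param e0 mul0r mulr0 scale0r addr0.
by rewrite /det3 !coordE; ring.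
Qed.

End LineParameter.

(** * Isolating a point by a form that vanishes on the scheme *)

Section Separation.
Variables (F : finFieldType) (q : nat).
Notation fun3 := {ffun 'rV[F]_3 -> F^o}.
Hypothesis hq : exists p m : nat, [/\ prime p, (0 < m)%N & q = (p ^ m)%N].
Hypothesis hF : #|F| = (q ^ 2)%N.
Variables (P1 P2 P3 Q1 Q2 Q3 : 'rV[F]_3) (c1 c2 c3 : F).
Hypotheses (hP1 : P1 \in hermPts F q) (hP2 : P2 \in hermPts F q) (hP3 : P3 \in hermPts F q).
Hypotheses (h12 : P1 != P2) (h13 : P1 != P3) (h23 : P2 != P3).
Hypothesis hnoncol : det3 P1 P2 P3 != 0.
Hypotheses (hc1 : c1 != 0) (hc2 : c2 != 0) (hc3 : c3 != 0).
Hypotheses (hQ1 : forall v, det3 v P1 Q1 = c1 * hform q v P1)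
  (hQ2 : forall v, det3 v P2 Q2 = c2 * hform q v P2)
  (hQ3 : forall v, det3 v P3 Q3 = c3 * hform q v P3).
Variables (d a1 a2 a3 : nat).
Hypotheses (hd5 : (5 <= d)%N) (hdq : (d < q)%N).
Hypotheses (ha1 : (0 < a1 <= d)%N) (ha2 : (0 < a2 <= d)%N) (ha3 : (0 < a3 <= d)%N).
Hypotheses (ha12 : (a1 + a2 < d.*2)%N) (ha13 : (a1 + a3 < d.*2)%N) (ha23 : (a2 + a3 < d.*2)%N).
Hypothesis hsum : (a1 + a2 + a3 <= 3 * d - 5)%N.

Notation VE := (contact3 P1 Q1 P2 Q2 P3 Q3 a1 a2 a3 d).
Notation B := (Bset q P1 P2 P3).

Let dF : (d.+1 < #|F|)%N.
Proof. by rewrite hF expnS expn1; move: hd5 hdq; clear; nia. Qed.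

Lemma tangent_det P Q c S : P \in hermPts F q -> c != 0 ->
  (forall v, det3 v P Q = c * hform q v P) -> S \in hermPts F q -> S != P -> det3 S P Q != 0.
Proof.
move=> hP c0 hQ hS SP; rewrite hQ mulf_neq0 //.
by apply: (tangent_only_at_point hq hF) => //; rewrite eq_sym.
Qed.

Lemma BsetP S : reflect [/\ S \in hermPts F q, S != P1, S != P2 & S != P3] (S \in B).
Proof.
rewrite !inE !negb_or -!andbA; apply: (iffP and5P) => [[]|[]].
  by move=> ? ? ? ? ?; split=> //; apply/andP.
by move=> /andP[].
Qed.

Lemma B_normalized S : S \in B -> normalized S.
Proof. by case/BsetP; rewrite hermPtsE => /andP[]. Qed.

Lemma indep1 : independent P1 Q1.
Proof. by exists P2; apply: (tangent_det hP1 hc1 hQ1 hP2); rewrite eq_sym. Qed.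
Lemma indep2 : independent P2 Q2.
Proof. by exists P1; apply: (tangent_det hP2 hc2 hQ2 hP1). Qed.
Lemma indep3 : independent P3 Q3.
Proof. by exists P1; apply: (tangent_det hP3 hc3 hQ3 hP1). Qed.

Lemma dim_VE_le e b1 b2 b3 : (2 < e < #|F|)%N ->
  (b1 <= e.+1)%N -> (b2 <= e.+1)%N -> (b3 <= e.+1)%N ->
  (b1 + b2 < e.*2.+2)%N -> (b1 + b3 < e.*2.+2)%N -> (b2 + b3 < e.*2.+2)%N ->
  (b1 + b2 + b3 < 3 * e)%N ->
  (\dim (contact3 P1 Q1 P2 Q2 P3 Q3 b1 b2 b3 e) + (b1 + b2 + b3) <= 'C(e.+2, 2))%N.
Proof.
move=> *; apply: dim_contact3_le => //.
- by apply: (tangent_det hP1 hc1 hQ1 hP2); rewrite eq_sym.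
- by apply: (tangent_det hP1 hc1 hQ1 hP3); rewrite eq_sym.
- exact: (tangent_det hP2 hc2 hQ2 hP1).
- by apply: (tangent_det hP2 hc2 hQ2 hP3); rewrite eq_sym.
- exact: (tangent_det hP3 hc3 hQ3 hP1).
- exact: (tangent_det hP3 hc3 hQ3 hP2).
Qed.

Lemma dim_VE : (\dim VE + (a1 + a2 + a3))%N = 'C(d.+2, 2).
Proof.
apply/eqP; rewrite eqn_leq dim_VE_le ?dim_contact3_ge //=;
  try (exact: indep1 || exact: indep2 || exact: indep3);
  move: dF hd5 ha1 ha2 ha3 ha12 ha13 ha23 hsum; move: #|F|; clear; lia.
Qed.

(** The product of the three tangents restricts to zero on each of them, so every contact condition
    holds, and it is nonzero at [s] because the tangents avoid [B]. *)
Lemma separated_VE n s T : d = n.+3 -> s \in B -> separated n s T ->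
  exists f : fun3, [/\ f \in VE, f s != 0 & {in T, forall x, f x = 0}].
Proof.
move=> dn /BsetP[sh s1 s2 s3] [g [gV gs gT]].
pose l1 v := det3 v P1 Q1; pose l2 v := det3 v P2 Q2; pose l3 v := det3 v P3 Q3.
exists (mulfun l1 (mulfun l2 (mulfun l3 g))); split.
- have l0 P Q t : det3 (P + t *: Q) P Q = 0 :> F by rewrite /det3 !coordE; ring.
  apply/contact3P; split.
  + by rewrite dn; do 3!(apply: mulfun_forms; first exact: linform_det).
  + rewrite -memv_preim lfunE /= (_ : restr _ _ _ = 0) ?mem0v //.
    by apply/ffunP=> t; rewrite !ffunE /l1 l0 mul0r.
  + rewrite -memv_preim lfunE /= (_ : restr _ _ _ = 0) ?mem0v //.
    by apply/ffunP=> t; rewrite !ffunE /l2 l0 mul0r mulr0.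
  + rewrite -memv_preim lfunE /= (_ : restr _ _ _ = 0) ?mem0v //.
    by apply/ffunP=> t; rewrite !ffunE /l3 l0 mul0r !mulr0.
- by rewrite !ffunE !mulf_neq0 //; [apply: (tangent_det hP1 hc1)|apply: (tangent_det hP2 hc2)
    |apply: (tangent_det hP3 hc3)].
by move=> x /gT gx; rewrite !ffunE gx !mulr0.
Qed.

Lemma contact_vanishes P Q a f : (0 < a)%N -> f \in forms F d -> f \in contact P Q a d -> f P = 0.
Proof.
move=> a0 fV; have [p sp pE] := forms_line_poly P Q fV.
rewrite (contactE _ (ltnW dF) sp pE) => /dvdpP[p' e].
have := pE 0; rewrite scale0r addr0 e hornerM hornerXn expr0n => ->.
by case: a a0 {e} => // a _; rewrite mulr0.
Qed.

(** Let [c] be the number of [P_i] on the line. Passing to degree [d - 1] lowers the binomial by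
    [d + 1] and the sum of the multiplicities by [c], so the rank is at least [d + 1 - c], the
    dimension allowed by the [c] zeros: every polynomial with these zeros is a restriction. *)
Lemma collinear_separated_VE (S : {set 'rV[F]_3}) s s' : S \subset B ->
  s \in S -> s' \in S -> s != s' -> {in S, forall x, det3 x s s' = 0} ->
  (#|S| + ((det3 P1 s s' == 0)%R + (det3 P2 s s' == 0)%R + (det3 P3 s s' == 0)%R) <= d.+1)%N ->
  exists f : fun3, [/\ f \in VE, f s != 0 & {in S :\ s, forall x, f x = 0}].
Proof.
move=> SB sS s'S ss' sl cS; set e_1 := (det3 P1 _ _ == 0) in cS; set e_2 := (det3 P2 _ _ == 0) in cS.
set e_3 := (det3 P3 _ _ == 0) in cS.
have nS x : x \in S -> normalized x by move=> /(subsetP SB) /B_normalized.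
have ns := nS _ sS; have ns' := nS _ s'S.
have [R D0] := normalized_free ns ns' ss'.
have PQ : independent s s' by exists R.
have ll := @linform_det F s s'.
pose T := line_param R s s'.
pose Ps := [seq P <- [:: P1; P2; P3] | det3 P s s' == 0].
have szPs : size Ps = (e_1 + e_2 + e_3)%N by rewrite /Ps /= -/e_1 -/e_2 -/e_3; do 3!case: ifP.
have PsP P : P \in Ps -> [/\ normalized P, P != s, P != s', det3 P s s' = 0 & {in VE, forall f :
  fun3, f P = 0}].
  have /BsetP[_ s1 s2 s3] := subsetP SB _ sS; have /BsetP[_ s1' s2' s3'] := subsetP SB _ s'S.
  have nP P' : P' \in hermPts F q -> normalized P' by rewrite hermPtsE => /andP[].
  have [/andP[p1 _] [/andP[p2 _] /andP[p3 _]]] := (ha1, (ha2, ha3)).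
  rewrite mem_filter !inE => /andP[/eqP lP /or3P[] /eqP eP]; split; rewrite // eP ?nP // 1?eq_sym //;
    move=> f /contact3P[fV f1 f2 f3].
  - exact: contact_vanishes p1 fV f1.
  - exact: contact_vanishes p2 fV f2.
  - exact: contact_vanishes p3 fV f3.
pose rs := map T Ps; pose G := \prod_(z <- rs) ('X - z%:P).
have szG : size G = (size Ps).+1 by rewrite size_prod_XsubC size_map.
have urs : uniq rs.
  rewrite map_inj_in_uniq; first by rewrite filter_uniq //= !inE negb_or h12 h13 h23.
  by move=> x y /PsP[nx _ xs' lx _] /PsP[ny _ ys' ly _]; apply: line_param_inj.
have onT (f : fun3) (h : {poly F}) (x : 'rV[F]_3) : (size h <= d.+1)%N -> (forall a b, f (a *: s +
  b *: s') = binform d h a b) ->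
    normalized x -> x != s' -> det3 x s s' = 0 -> exists2 b, b != 0 & f x = b * h.[T x].
  move=> sh hE nx xs' lx; have d0 := line_coord_neq0 D0 ns' nx xs' lx.
  exists ((det3 R x s' / det3 R s s') ^+ d); first by rewrite expf_neq0 // mulf_neq0 ?invr_eq0.
  by rewrite {1}(line_paramE D0 lx d0) hE binform_scale.
have imG : (linfun (restr s s') @: VE <= polyspace G (d.+1 - size Ps))%VS.
  apply/subvP=> r /memv_imgP[f fV ->]; rewrite lfunE /=.
  have /contact3P[fd _ _ _] := fV; have [h sh hE] := independent_binform PQ fd.
  have rh : all (root h) rs.
    apply/allP=> _ /mapP[P PPs ->]; have [nP _ Ps' lP fP] := PsP P PPs.
    have [b b0] := onT f h P sh hE nP Ps' lP; rewrite fP // => /esym/eqP.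
    by rewrite mulf_eq0 (negPf b0).
  have [||h' hh'] := @uniq_roots_prod_XsubC _ h rs _ _; rewrite ?uniq_rootsE //.
  apply/polyspaceP; exists h'; last first.
    move=> t; rewrite ffunE mulrC -hornerM -hh' -(binform1 t sh) -hE scale1r //.
  have [->|h0] := eqVneq h' 0; first by rewrite size_poly0.
  move: sh; rewrite hh' size_Mmonic ?monic_prod_XsubC // -/G szG addnS /=.
  by move: (size h') (size Ps); clear; lia.
have [e de] : exists e, d = e.+1 by exists d.-1; move: hd5; clear; lia.
have dimW : (\dim (contact3 P1 Q1 P2 Q2 P3 Q3 (a1 - e_1) (a2 - e_2) (a3 - e_3) e)
    + ((a1 - e_1) + (a2 - e_2) + (a3 - e_3)) <= 'C(e.+2, 2))%N.
  have dF' : (e < #|F|)%N by apply: leq_trans dF; rewrite de; clear; lia.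
  apply: dim_VE_le; rewrite ?dF' ?andbT; move: hd5 ha1 ha2 ha3 ha12 ha13 ha23 hsum;
    rewrite de; move: (leq_b1 e_1) (leq_b1 e_2) (leq_b1 e_3);
      move: (nat_of_bool e_1) (nat_of_bool e_2) (nat_of_bool e_3); clear; lia.
(* A line through [P] and [Q] is the tangent at [P], which does not contain [s]; so the line [s s']
   crosses it transversally. *)
have lQ P Q c : P \in hermPts F q -> c != 0 -> (forall v, det3 v P Q = c * hform q v P) -> s != P ->
    det3 P s s' = 0 -> det3 Q s s' != 0.
  move=> hP c0 hQ sP lP; apply/eqP=> lQ.
  have /BsetP[sh _ _ _] := subsetP SB _ sS.
  case/eqP: (tangent_det hP c0 hQ sh sP); apply: (linform_det3_eq0 ll D0) => //.
  by rewrite /det3; ring.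
have leF : (e.+1 < #|F|)%N by rewrite -de; apply: ltnW.
have /BsetP[_ s1 s2 s3] := subsetP SB _ sS.
have dimU : (\dim VE <= \dim (linfun (restr s s') @: VE)%VS
    + \dim (contact3 P1 Q1 P2 Q2 P3 Q3 (a1 - e_1) (a2 - e_2) (a3 - e_3) e))%N.
  rewrite de; apply: (dim_le_restr PQ leF); first by apply/subvP=> f /contact3P[].
  move=> g gV /contact3P[_ g1 g2 g3]; apply/contact3P; split=> //.
  - by apply: (contact_mulfun ll _ leF gV g1) => lP; apply: (lQ _ _ _ hP1 hc1 hQ1 s1 lP).
  - by apply: (contact_mulfun ll _ leF gV g2) => lP; apply: (lQ _ _ _ hP2 hc2 hQ2 s2 lP).
  - by apply: (contact_mulfun ll _ leF gV g3) => lP; apply: (lQ _ _ _ hP3 hc3 hQ3 s3 lP).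
have {dimU dimW} dimI : (d.+1 - size Ps <= \dim (linfun (restr s s') @: VE)%VS)%N.
  have bS : 'C(d.+2, 2) = ('C(d.+1, 2) + d.+1)%N by rewrite binS bin1.
  have := dim_VE; move: dimU dimW ha1 ha2 ha3; rewrite szPs bS -de.
  move: (\dim _) (\dim _) (\dim _) 'C(_, _) => n1 n2 n3 n4.
  by move: (leq_b1 e_1) (leq_b1 e_2) (leq_b1 e_3); move: (nat_of_bool e_1) (nat_of_bool e_2)
    (nat_of_bool e_3); clear; lia.
have {imG dimI} imE : (linfun (restr s s') @: VE)%VS = polyspace G (d.+1 - size Ps).
  by apply/eqP; rewrite eqEdim imG (leq_trans (dim_polyspace_le _ _)).
(* No factor for [s'], which lies at infinity: the form vanishes there because [G * p] has degree
   below [d]. The bound on [#|S|] is what ensures this. *)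
pose ts := map T (enum (S :\ s :\ s')).
pose p := \prod_(z <- ts) ('X - z%:P).
have szp : size p = #|S|.-1.
  rewrite size_prod_XsubC size_map -cardE; have := cardsD1 s S; have := cardsD1 s' (S :\ s).
  by rewrite !inE sS s'S eq_sym ss' /=; move: #|_| #|_| #|_|; clear; lia.
have cS2 : (1 < #|S|)%N by apply/card_gt1P; exists s, s'.
have : [ffun t => G.[t] * p.[t]] \in (linfun (restr s s') @: VE)%VS.
  rewrite imE; apply/polyspaceP; exists p; last by move=> t; rewrite ffunE.
  by rewrite szp szPs; move: cS cS2; move: #|S|; move: (leq_b1 e_1) (leq_b1 e_2) (leq_b1 e_3);
    move: (nat_of_bool e_1) (nat_of_bool e_2) (nat_of_bool e_3); clear; lia.
case/memv_imgP=> f fV; rewrite lfunE /= => /ffunP fE.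
have /contact3P[fd _ _ _] := fV; have [h sh hE] := independent_binform PQ fd.
have szGp : (size (G * p)%R <= d)%N.
  apply: leq_trans (size_polyMleq _ _) _; rewrite szG szp szPs.
  by move: cS cS2; move: #|S|; move: (leq_b1 e_1) (leq_b1 e_2) (leq_b1 e_3);
    move: (nat_of_bool e_1) (nat_of_bool e_2) (nat_of_bool e_3); clear; lia.
have hGp : h = G * p.
  apply: poly_fun_inj; [by apply: leq_trans sh _; apply: ltnW|by apply: leq_trans szGp _;
    do 2!apply: ltnW|].
  by move=> t; rewrite hornerM; have := fE t; rewrite !ffunE => ->;
    rewrite -(binform1 t sh) -hE scale1r.
exists f; split=> //.
  have -> : f s = h.[0] by rewrite -(binform1 0 sh) -hE scale1r scale0r addr0.
  rewrite hGp -[_ == 0]/(root _ 0) rootM !root_prod_XsubC negb_or; apply/andP; split.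
    apply/negP=> /mapP[P /PsP[nP Ps_ Ps' lP _]] /esym/eqP; apply/negP.
    exact: line_param_neq0.
  apply/negP=> /mapP[x]; rewrite mem_enum !inE => /and3P[xs' xs xS] /esym/eqP; apply/negP.
  by apply: line_param_neq0 => //; [apply: nS|apply: sl].
move=> x /setD1P[xs xS]; have [->|xs'] := eqVneq x s'.
  have := hE 0 1; rewrite scale0r add0r scale1r binform01 => ->.
  by rewrite nth_default // hGp.
have [b _ ->] := onT f h x sh hE (nS _ xS) xs' (sl _ xS).
suff /eqP-> : root h (T x) by rewrite mulr0.
by rewrite hGp rootM !root_prod_XsubC; apply/orP; right; apply: map_f; rewrite mem_enum !inE xs' xs.
Qed.

(** The last hypothesis expresses that [S] supports a dual word: if [f] vanishes on the rest of [S],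
    the pairing reduces to its term at [s]. *)
Lemma separation (S : {set 'rV[F]_3}) : S \subset B -> S != set0 -> (#|S| <= d)%N ->
  (forall (f : fun3) s, f \in VE -> s \in S -> {in S :\ s, forall x, f x = 0} -> f s = 0) ->
  #|S| = d /\ [\/ {in S, forall x, det3 x P2 P3 = 0}, {in S, forall x, det3 x P1 P3 = 0}
    | {in S, forall x, det3 x P1 P2 = 0}].
Proof.
move=> SB S0 cS nosep; have [n dn] : exists n, d = n.+3 by exists (d - 3)%N; move: hd5; clear; lia.
have nS : {in S, forall x, normalized x} by move=> x /(subsetP SB) /B_normalized.
have nosep' s : s \in S -> ~ exists f : fun3, [/\ f \in VE, f s != 0 & {in S :\ s, forall x, f x =
  0}].
  by move=> sS [f [fV fs fT]]; rewrite (nosep f s) ?eqxx in fs.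
have [||[s sS]|[cSn [s [s' [sS s'S ss' sl]]]]] := separated_or_collinear _ S0 nS (_ : (#|S| <=
  n.+3)%N).
- by move: hd5; rewrite dn; clear; lia.
- by rewrite -dn.
- by move/(separated_VE dn (subsetP SB _ sS)) /(nosep' _ sS).
have [R D0] := normalized_free (nS _ sS) (nS _ s'S) ss'.
have ll := @linform_det F s s'.
have {nosep'} : ~~ (#|S| + ((det3 P1 s s' == 0)%R + (det3 P2 s s' == 0)%R + (det3 P3 s s' == 0)%R)
  <= d.+1)%N.
  apply/negP=> le; exact: (nosep' s sS (collinear_separated_VE SB sS s'S ss' sl le)).
case: eqP => e1; case: eqP => e2; case: eqP => e3 lt; try by move: lt cS; move: #|S|; clear; lia.
- by case/eqP: hnoncol; apply: (linform_det3_eq0 ll D0).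
- by split; [by move: lt cS; move: #|S|; clear; lia|constructor 3 => x xS;
    apply: (linform_det3_eq0 ll D0) => //; apply: sl].
- by split; [by move: lt cS; move: #|S|; clear; lia|constructor 2 => x xS;
    apply: (linform_det3_eq0 ll D0) => //; apply: sl].
- by split; [by move: lt cS; move: #|S|; clear; lia|constructor 1 => x xS;
    apply: (linform_det3_eq0 ll D0) => //; apply: sl].
Qed.

End Separation.

(** * The code *)

Section Injectivity.
Variables (F : finFieldType) (q : nat).
Notation fun3 := {ffun 'rV[F]_3 -> F^o}.
Hypothesis hq : exists p m : nat, [/\ prime p, (0 < m)%N & q = (p ^ m)%N].
Hypothesis hF : #|F| = (q ^ 2)%N.
Implicit Types (P Q v x : 'rV[F]_3) (f : fun3).

Lemma forms_homogeneous d f c v : f \in forms F d -> f (c *: v) = c ^+ d * f v.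
Proof.
move=> fV; elim/forms_ind: f / fV => [|a f g ef eg|i j k e].
- by rewrite !ffunE mulr0.
- by rewrite !ffunE ef eg mulrDr /GRing.scale /= mulrCA.
by rewrite !ffunE !coordE !exprMn -e !exprD; ring.
Qed.

Lemma herm_line v P t : P \in hermPts F q ->
  hform q (v + t *: P) (v + t *: P) = (t * hform q P v) ^+ q + t * hform q P v + hform q v v.
Proof.
rewrite hermPtsE => /andP[_ /eqP hP].
rewrite hformD !(hformDr hq hF) !hformZ !hformZr hP [hform q v P](hformC hq hF) exprMn.
by ring.
Qed.

(** With [u = t * hform P v] the equation reads [u^q + u = - hform v v], a trace fibre over an
    element fixed by the Frobenius. So a line through [P] other than the tangent has [q] further
    points on the curve. *)
Lemma card_herm_line v P : P \in hermPts F q -> hform q v P != 0 ->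
  #|[set t | hform q (v + t *: P) (v + t *: P) == 0]| = q.
Proof.
move=> hP vP; set b := hform q P v.
have b0 : b != 0 by apply: contraNneq vP => b0; rewrite (hformC hq hF) -/b b0 expr0n gtn_eqF //
  ltnW // q_gt1.
rewrite -[RHS](card_trace_fiber hq hF (_ : (- hform q v v) ^+ q = - hform q v v)); last first.
  by rewrite (frobN hq hF) -(hformC hq hF).
rewrite -[LHS](card_imset _ (mulIf b0)); apply: eq_card => u; rewrite inE.
apply/imsetP/eqP => [[t]|e].
  by rewrite inE herm_line // -/b => /eqP e ->; apply/eqP; rewrite -addr_eq0 e.
exists (u / b); last by rewrite divfK.
by rewrite inE herm_line // -/b divfK // e addNr.
Qed.

Lemma hermPts_scale x : x != 0 -> hform q x x = 0 -> exists2 c, c != 0 & c *: x \in hermPts F q.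
Proof.
move=> x0 hx; have [c c0 nc] := normalized_scale x0; exists c => //.
by rewrite hermPtsE nc hformZ hformZr hx !mulr0 eqxx.
Qed.

(** A line through [P1] that is not the tangent and misses [P2] and [P3] has [q > d] points in [B],
    so [f] vanishes on it. The product of [f] with the three excluded lines is therefore zero, and
    these factors cancel one by one. *)
Lemma forms_vanishing_on_B d P1 P2 P3 Q1 c1 f :
  P1 \in hermPts F q -> P2 \in hermPts F q -> P3 \in hermPts F q -> det3 P1 P2 P3 != 0 ->
  c1 != 0 -> (forall v, det3 v P1 Q1 = c1 * hform q v P1) -> independent P1 Q1 ->
  (2 < d)%N -> (d < q)%N -> f \in forms F d -> {in Bset q P1 P2 P3, forall x, f x = 0} -> f = 0.
Proof.
move=> hP1 hP2 hP3 nc c0 hQ1 i1 d2 dq fV fB.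
have off v : hform q v P1 != 0 -> det3 v P1 P2 != 0 -> det3 v P1 P3 != 0 -> f v = 0.
  move=> v1 v2 v3; have [p sp pE] := forms_line_poly v P1 fV.
  suff p0 : p = 0 by have := pE 0; rewrite scale0r addr0 p0 horner0.
  apply/eqP/negPn/negP=> p0; have := card_root_le p0 sp; rewrite leqNgt => /negP; apply.
  apply: leq_trans dq _; rewrite -(card_herm_line hP1 v1); apply: subset_leq_card.
  apply/subsetP=> t; rewrite !inE => /eqP hx; set x := v + t *: P1 in hx.
  have hP11 : hform q P1 P1 = 0 by move: hP1; rewrite hermPtsE => /andP[_ /eqP].
  have x1 : hform q x P1 != 0 by rewrite /x hformD hformZ hP11 mulr0 addr0.
  have x0 : x != 0 by apply: contraNneq x1 => ->; rewrite /hform !coordE !mul0r subr0 addr0.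
  have [c cn0 cx] := hermPts_scale x0 hx.
  have fx : f (c *: x) = 0.
    apply: fB; apply/BsetP; split=> //.
    - by apply: contraNneq x1 => e; rewrite -(mulrI_eq0 _ (mulfI cn0)) -hformZ e hP11.
    - apply: contraNneq v2 => e; rewrite -(mulrI_eq0 _ (mulfI cn0)).
      by rewrite -e /x /det3 !coordE; apply/eqP; ring.
    - apply: contraNneq v3 => e; rewrite -(mulrI_eq0 _ (mulfI cn0)).
      by rewrite -e /x /det3 !coordE; apply/eqP; ring.
  move/eqP: fx; rewrite (forms_homogeneous _ _ fV) mulf_eq0 expf_eq0 (negPf cn0) andbF /=.
  by rewrite /root -pE.
have i2 : independent P1 P2.
  by exists P3; rewrite (_ : det3 _ _ _ = det3 P1 P2 P3) // /det3; ring.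
have i3 : independent P1 P3.
  exists P2; rewrite (_ : det3 _ _ _ = - det3 P1 P2 P3) ?oppr_eq0 // /det3; ring.
have lF : (d.+3 < #|F|)%N by rewrite hF expnS expn1; move: d2 dq; clear; nia.
apply: (mulfun_det_inj i3 _ fV); first by do 2!apply: ltnW.
have f3V := mulfun_forms (@linform_det F P1 P3) fV.
apply: (mulfun_det_inj i2 _ f3V); first by apply: ltnW.
have f2V := mulfun_forms (@linform_det F P1 P2) f3V.
apply: (mulfun_det_inj i1 _ f2V) => //.
apply/ffunP=> v; rewrite !ffunE hQ1.
have [->|v1] := eqVneq (hform q v P1) 0; first by rewrite mulr0 mul0r.
have [->|v2] := eqVneq (det3 v P1 P2) 0; first by rewrite mul0r mulr0.
have [->|v3] := eqVneq (det3 v P1 P3) 0; first by rewrite mul0r !mulr0.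
by rewrite off // !mulr0.
Qed.

Lemma card_Bset P1 P2 P3 : P1 \in hermPts F q -> P2 \in hermPts F q -> P3 \in hermPts F q ->
  P1 != P2 -> P1 != P3 -> P2 != P3 -> #|Bset q P1 P2 P3| = (q ^ 3 - 2)%N.
Proof.
move=> hP1 hP2 hP3 h12 h13 h23; rewrite /Bset cardsD card_hermPts //.
have -> : hermPts F q :&: [set P1; P2; P3] = [set P1; P2; P3].
  by apply/setIidPr/subsetP=> x; rewrite in_setU in_set2 in_set1 -orbA => /or3P[] /eqP->.
rewrite setUC cardsU1 cards2 !inE negb_or h12 !(eq_sym P3) h13 h23 /=.
by rewrite subSS.
Qed.

End Injectivity.

(** * Dimension, minimum distance and words of minimal weight *)

Section Code.
Variables (F : finFieldType) (q : nat).
Notation fun3 := {ffun 'rV[F]_3 -> F^o}.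
Hypothesis hq : exists p m : nat, [/\ prime p, (0 < m)%N & q = (p ^ m)%N].
Hypothesis hF : #|F| = (q ^ 2)%N.
Variables (P1 P2 P3 Q1 Q2 Q3 : 'rV[F]_3) (c1 c2 c3 : F).
Hypotheses (hP1 : P1 \in hermPts F q) (hP2 : P2 \in hermPts F q) (hP3 : P3 \in hermPts F q).
Hypotheses (h12 : P1 != P2) (h13 : P1 != P3) (h23 : P2 != P3).
Hypothesis hnoncol : det3 P1 P2 P3 != 0.
Hypotheses (hc1 : c1 != 0) (hc2 : c2 != 0) (hc3 : c3 != 0).
Hypotheses (hQ1 : forall v, det3 v P1 Q1 = c1 * hform q v P1)
  (hQ2 : forall v, det3 v P2 Q2 = c2 * hform q v P2)
  (hQ3 : forall v, det3 v P3 Q3 = c3 * hform q v P3).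
Variables (d a1 a2 a3 : nat).
Hypotheses (hd5 : (5 <= d)%N) (hdq : (d < q)%N).
Hypotheses (ha1 : (0 < a1 <= d)%N) (ha2 : (0 < a2 <= d)%N) (ha3 : (0 < a3 <= d)%N).
Hypotheses (ha12 : (a1 + a2 < d.*2)%N) (ha13 : (a1 + a3 < d.*2)%N) (ha23 : (a2 + a3 < d.*2)%N).
Hypothesis hsum : (a1 + a2 + a3 <= 3 * d - 5)%N.

Notation VE := (contact3 P1 Q1 P2 Q2 P3 Q3 a1 a2 a3 d).
Notation B := (Bset q P1 P2 P3).
Notation code := (codeC q P1 P2 P3 d a1 a2 a3).

Definition eval_on_B (f : fun3) : 'rV[F]_#|B| := \row_k f (Bpt k).

Fact eval_on_B_linear : linear eval_on_B.
Proof. by move=> a f g; apply/rowP=> k; rewrite !mxE !ffunE. Qed.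
HB.instance Definition _ := GRing.isLinear.Build _ _ _ _ _ eval_on_B_linear.

Lemma mem_code w : reflect (exists2 f, f \in VE & w = eval_on_B f) (w \in code).
Proof.
have ev (M : 'M[F]_(d.+1, d.+1)) : evB q P1 P2 P3 M = eval_on_B (feval M).
  by apply/rowP=> k; rewrite !mxE ffunE.
have vE (M : 'M[F]_(d.+1, d.+1)) : [&& vanishes_on_multiple q a1 M P1, vanishes_on_multiple q a2 M P2
    & vanishes_on_multiple q a3 M P3] = (feval M \in VE).
  rewrite (vanishes_contact hq hF M hP1 hc1 hQ1 ha1 hdq) (vanishes_contact hq hF M hP2 hc2 hQ2 ha2
    hdq).
  rewrite (vanishes_contact hq hF M hP3 hc3 hQ3 ha3 hdq) !memv_cap -!andbA.
  by rewrite (introT (formsP _ _) (ex_intro _ M erefl)).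
apply: (iffP imsetP) => [[M]|[f fV ->]].
  by rewrite inE vE => fV ->; exists (feval M).
have /contact3P[/formsP[M fM] _ _ _] := fV.
by exists M; rewrite ?inE ?vE -?fM ?ev -?fM.
Qed.

Lemma code_dimE : (code_dim code + (a1 + a2 + a3))%N = 'C(d.+2, 2).
Proof.
rewrite -(dim_VE hq hF hP1 hP2 hP3 h12 h13 h23 hc1 hc2 hc3 hQ1 hQ2 hQ3 hd5 hdq ha1 ha2 ha3 ha12
  ha13 ha23 hsum).
congr (_ + _)%N; rewrite /code_dim.
have -> : (<<enum code>> = linfun eval_on_B @: VE)%VS.
  apply/eqP; rewrite eqEsubv; apply/andP; split.
    apply/span_subvP=> w; rewrite mem_enum => /mem_code[f fV ->].
    by apply/memv_imgP; exists f; rewrite ?lfunE.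
  apply/subvP=> w /memv_imgP[f fV ->]; rewrite lfunE /=; apply: memv_span.
  by rewrite mem_enum; apply/mem_code; exists f.
rewrite limg_dim_eq //; apply/eqP; rewrite -subv0; apply/subvP=> f /memv_capP[/contact3P[fV _ _ _]].
rewrite memv_ker lfunE /= memv0 => /eqP/rowP f0; apply/eqP.
have i1 : independent P1 Q1.
  by exists P2; apply: (tangent_det hq hF hP1 hc1 hQ1 hP2); rewrite eq_sym.
apply: (forms_vanishing_on_B hq hF hP1 hP2 hP3 hnoncol hc1 hQ1 i1 _ hdq fV).
  by move: hd5; clear; lia.
move=> x xB; have := f0 (enum_rank_in xB x); rewrite !mxE /Bpt enum_rankK_in //.
Qed.

Lemma mem_dual_code (w : 'rV[F]_#|B|) :
  reflect (forall f, f \in VE -> \sum_k (f (Bpt k) : F) * w ord0 k = 0) (w \in dual_code code).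
Proof.
have dotE (f : fun3) : \sum_k (f (Bpt k) : F) * w ord0 k = \sum_k eval_on_B f ord0 k * w ord0 k.
  by apply: eq_bigr => k _; rewrite mxE.
rewrite inE; apply: (iffP forall_inP) => [h f fV|h c /mem_code[f fV ->]].
  by rewrite dotE; apply/eqP/h/mem_code; exists f.
by rewrite -dotE h.
Qed.

Lemma Bpt_inj : injective (@Bpt F q P1 P2 P3).
Proof. exact: enum_val_inj. Qed.

Lemma card_suppB (w : 'rV[F]_#|B|) : #|suppB w| = weight w.
Proof. by rewrite /suppB card_imset //; apply: Bpt_inj. Qed.

Lemma suppB_sub (w : 'rV[F]_#|B|) : suppB w \subset B.
Proof. by apply/subsetP=> _ /imsetP[k _ ->]; apply: enum_valP. Qed.

Lemma low_weight_support w : w \in dual_code code -> w != 0 -> (weight w <= d)%N ->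
  weight w = d /\ [\/ {in suppB w, forall x, det3 x P2 P3 = 0},
    {in suppB w, forall x, det3 x P1 P3 = 0} | {in suppB w, forall x, det3 x P1 P2 = 0}].
Proof.
move=> /mem_dual_code wC w0 wd; rewrite -card_suppB.
apply: (separation hq hF hP1 hP2 hP3 h12 h13 h23 hnoncol hc1 hc2 hc3 hQ1 hQ2 hQ3 hd5 hdq ha1 ha2 ha3
  ha12 ha13 ha23 hsum (suppB_sub w)) => //.
- apply: contraNneq w0 => s0; apply/eqP/rowP=> k; rewrite mxE; apply/eqP/negPn/negP=> wk.
  by have := in_set0 (Bpt k); rewrite -s0 => /negP; apply; apply: imset_f; rewrite inE.
- by rewrite card_suppB.
move=> f s fV /imsetP[k]; rewrite inE => wk -> fT.
have := wC f fV; rewrite (bigD1 k) //= big1 ?addr0 => [|j jk].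
  by move/eqP; rewrite mulf_eq0 (negPf wk) orbF => /eqP.
have [->|wj] := eqVneq (w ord0 j) 0; first by rewrite mulr0.
rewrite fT ?mul0r // in_setD1 (inj_eq Bpt_inj) jk /=.
by apply: imset_f; rewrite inE.
Qed.

Lemma weight_ge w : w \in dual_code code -> w != 0 -> (d <= weight w)%N.
Proof.
move=> wC w0; have [//|lt] := leqP d (weight w).
by have [e _] := low_weight_support wC w0 (ltnW lt); rewrite e ltnn in lt.
Qed.

(** The line [P2P3] is not a tangent, so [q] of its points [P2 + t *: P3] lie on the curve.
    Discarding [t = 0], which is [P2], leaves [q - 1 >= d] of them; [c] normalizes the
    representatives. *)
Lemma exists_points_on_line : exists (t c : 'I_d -> F) (k : 'I_d -> 'I_#|B|),
  [/\ injective t, forall i, t i != 0, forall i, c i != 0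
    & forall i, Bpt (k i) = c i *: (P2 + t i *: P3)].
Proof.
pose Z := [set t | hform q (P2 + t *: P3) (P2 + t *: P3) == 0] :\ 0.
have v23 : hform q P2 P3 != 0 by apply: (tangent_only_at_point hq hF) => //; rewrite eq_sym.
have h22 : hform q P2 P2 = 0 by move: hP2; rewrite hermPtsE => /andP[_ /eqP].
have cZ : (d <= #|Z|)%N.
  have := card_herm_line hq hF hP3 v23; rewrite (cardsD1 0) inE scale0r addr0 h22 eqxx add1n => e.
  by rewrite -ltnS [#|Z|.+1]e.
pose t (i : 'I_d) := enum_val (widen_ord cZ i).
have tZ i : t i \in Z by apply: enum_valP.
have /fin_all_exists2[c c0 cP] i : exists2 c, c != 0 & c *: (P2 + t i *: P3) \in B.
  have /setD1P[t0] := tZ i; rewrite inE => /eqP hx.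
  have x0 : P2 + t i *: P3 != 0.
    apply: contraNneq hnoncol => e; have <- : det3 P1 (P2 + t i *: P3) P3 = det3 P1 P2 P3.
      by rewrite /det3 !coordE; ring.
    by rewrite e /det3 !coordE; apply/eqP; ring.
  have [b b0 bx] := hermPts_scale x0 hx; exists b => //; apply/BsetP; split=> //.
  - apply: contraNneq hnoncol => <-; rewrite /det3 !coordE; apply/eqP; ring.
  - apply: contraNneq hnoncol => e.
    suff : b * t i * det3 P1 P2 P3 = 0 by move/eqP; rewrite !mulf_eq0 (negPf b0) (negPf t0).
    transitivity (det3 P1 P2 (b *: (P2 + t i *: P3))); first by rewrite /det3 !coordE; ring.
    by rewrite e /det3; ring.
  - apply: contraNneq hnoncol => e.
    suff : b * det3 P1 P2 P3 = 0 by move/eqP; rewrite !mulf_eq0 (negPf b0).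
    transitivity (det3 P1 (b *: (P2 + t i *: P3)) P3); first by rewrite /det3 !coordE; ring.
    by rewrite e /det3; ring.
exists t, c, (fun i => enum_rank_in (cP i) (c i *: (P2 + t i *: P3))); split=> //.
- by move=> i j /enum_val_inj /(congr1 val) /= e; apply: val_inj.
- by move=> i; have /setD1P[] := tZ i.
- by move=> i; rewrite /Bpt enum_rankK_in.
Qed.

(* On the line P2P3 the code takes the values t p(t) with deg p <= d - 2, so that any d points of
   that line carry a linear dependency. *)
Lemma exists_word_weight_d : exists2 w, w \in dual_code code & (w != 0) && (weight w == d).
Proof.
have [t [c [k [t_inj t0 c0 kE]]]] := exists_points_on_line.
have k_inj : injective k.
  move=> i j e; have := congr1 (@Bpt F q P1 P2 P3) e; rewrite !kE => ePQ.
  have ec : c i = c j.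
    apply: (mulIf hnoncol); transitivity (det3 P1 (c i *: (P2 + t i *: P3)) P3).
      by rewrite /det3 !coordE; ring.
    by rewrite ePQ /det3 !coordE; ring.
  apply: t_inj; apply: (mulfI (c0 i)); apply: (mulIf hnoncol).
  transitivity (det3 P1 P2 (c i *: (P2 + t i *: P3))); first by rewrite /det3 !coordE; ring.
  by rewrite ePQ ec /det3 !coordE; ring.
(* With more rows than columns, [A] has a nonzero left kernel vector: a relation between the values
   at the [t i] of all polynomials of degree at most [d - 2]. *)
pose A : 'M[F]_(d, d.-1) := \matrix_(i, j) t i ^+ j.
have [y y0 yA] : exists2 y : 'rV_d, y != 0 & y *m A = 0.
  have : kermx A != 0.
    rewrite kermx_eq0 /row_free; apply/eqP=> e; have := rank_leq_col A; rewrite e.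
    by move: hd5; clear; lia.
  case/rowV0Pn=> y yk y0; exists y => //; exact/sub_kermxP.
(* At the chosen representative a form takes the value [c_i^d t_i p(t_i)]; the denominator removes
   the scaling and the zero at [P2]. *)
pose z i := y ord0 i / (c i ^+ d * t i).
pose w : 'rV[F]_#|B| := \row_l \sum_(i | k i == l) z i.
have wk i : w ord0 (k i) = z i.
  by rewrite mxE (bigD1 i) //= big1 ?addr0 // => j /andP[/eqP/k_inj-> /eqP].
have wC : w \in dual_code code.
  apply/mem_dual_code=> f fV; have /contact3P[fd _ f2 f3] := fV.
  have i23 : independent P2 P3 by exists P1.
  have [h sh hE] := independent_binform i23 fd.
  have dF : (d.+1 < #|F|)%N by rewrite hF expnS expn1; move: hd5 hdq; clear; nia.
  have [/andP[p2 _] /andP[p3 _]] := (ha2, ha3).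
  have h0 : h.[0] = 0.
    have := contact_vanishes hF hd5 hdq p2 fd f2.
    by rewrite -(binform1 0 sh) -hE scale1r scale0r addr0.
  (* The parameter of [P3] is infinite, so vanishing there lowers the degree by one. *)
  have hd : h`_d = 0.
    have := contact_vanishes hF hd5 hdq p3 fd f3.
    by rewrite -binform01 -hE scale1r scale0r add0r.
  have {}sh' : (size h <= d)%N.
    by apply/leq_sizeP=> j; rewrite leq_eqVlt => /predU1P[<-//|dj];
      rewrite nth_default // (leq_trans sh).
  have /factor_theorem[p hp] : root h 0 by apply/eqP.
  rewrite subr0 in hp.
  have sp : (size p <= d.-1)%N.
    have [->|p0] := eqVneq p 0; first by rewrite size_poly0.
    move: sh'; rewrite hp size_mulX //; move: (size p) => m; clear; lia.
  transitivity (\sum_i f (Bpt (k i)) * z i).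
    transitivity (\sum_l \sum_(i | k i == l) f (Bpt (k i)) * z i).
      apply: eq_bigr => l _; rewrite mxE mulr_sumr; apply: eq_bigr => i /eqP-> //.
    by rewrite (exchange_big_dep xpredT) //=; apply: eq_bigr => i _;
      rewrite (big_pred1 (k i)) // => l; rewrite /= eq_sym.
  transitivity (\sum_i y ord0 i * p.[t i]).
    apply: eq_bigr => i _; rewrite kE (forms_homogeneous _ _ fd).
    have -> : f (P2 + t i *: P3) = p.[t i] * t i.
      by have := hE 1 (t i); rewrite scale1r binform1 // hp hornerM hornerX.
    by rewrite /z; field; rewrite t0 expf_neq0.
  transitivity (\sum_(j < d.-1) p`_j * (y *m A) ord0 j); last by rewrite yA big1 // => j _;
    rewrite mxE mulr0.
  under eq_bigr => i _ do rewrite (horner_coef_wide _ sp) mulr_sumr.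
  rewrite exchange_big /=; apply: eq_bigr => j _; rewrite mxE mulr_sumr; apply: eq_bigr => i _.
  by rewrite mxE; ring.
have w0 : w != 0.
  apply: contraNneq y0 => w0; apply/eqP/rowP=> i; rewrite mxE.
  have := wk i; rewrite w0 mxE /z => /esym/eqP; rewrite mulf_eq0 invr_eq0 mulf_eq0 (negPf (t0 i)).
  by rewrite expf_eq0 (negPf (c0 i)) andbF !orbF => /eqP.
(* By construction at most [d] entries are nonzero; the lower bound on the weight excludes a smaller
   support. *)
exists w => //; rewrite w0 /= eqn_leq weight_ge // andbT.
apply: leq_trans (_ : #|k @: 'I_d| <= d)%N; last by rewrite -[X in (_ <= X)%N]card_ord leq_imset_card.
apply: subset_leq_card; apply/subsetP=> l; rewrite inE mxE => wl.
apply/negPn/negP=> lk; case/eqP: wl; rewrite big1 // => i /eqP e; case/negP: lk.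
by rewrite -e imset_f.
Qed.

End Code.

Theorem theorem4p1 (F : finFieldType) (q : nat)
  (hq : exists p m : nat, [/\ prime p, (0 < m)%N & q = (p ^ m)%N])
  (hF : #|F| = (q ^ 2)%N)
  (P1 P2 P3 : 'rV[F]_3)
  (hP1 : P1 \in hermPts F q) (hP2 : P2 \in hermPts F q) (hP3 : P3 \in hermPts F q)
  (h12 : P1 != P2) (h13 : P1 != P3) (h23 : P2 != P3)
  (hnoncol : \det (mx3 P1 P2 P3) != 0)
  (d a1 a2 a3 : nat)
  (hd5 : (5 <= d)%N) (hd1 : (1 <= d)%N) (hdq : (d <= q - 1)%N)
  (ha1 : (1 <= a1 <= d)%N) (ha2 : (1 <= a2 <= d)%N) (ha3 : (1 <= a3 <= d)%N)
  (hsum : (a1 + a2 + a3 <= 3 * d - 5)%N)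
  (hatmost : ((a1 == d) + (a2 == d) + (a3 == d) <= 1)%N) :
  let C := codeC q P1 P2 P3 d a1 a2 a3 in
  let Cp := dual_code C in
  let L := fun i : 'I_3 =>
    if (i == 0 :> nat) then line_through P2 P3
    else if (i == 1 :> nat) then line_through P1 P3
    else line_through P1 P2 in
  [/\ #|Bset q P1 P2 P3| = (q ^ 3 - 2)%N,
      (code_dim C + (a1 + a2 + a3))%N = 'C(d.+2, 2),
      (exists2 w, w \in Cp & (w != 0) && (weight w == d)),
      (forall w, w \in Cp -> w != 0 -> (d <= weight w)%N)
    & (forall w, w \in Cp -> w != 0 ->
        (weight w = d <->
         (exists i : 'I_3, #|suppB w| = d /\ suppB w \subset Bset q P1 P2 P3 :&: L i)))].
Proof.
move=> C Cp L.
have dq : (d < q)%N by move: hd5 hdq; clear; lia.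
(* At most one multiplicity equals [d], restated as the pairwise bounds of the dimension count. *)
have [b12 b13 b23] : [/\ (a1 + a2 < d.*2)%N, (a1 + a3 < d.*2)%N & (a2 + a3 < d.*2)%N].
  move: ha1 ha2 ha3 hatmost; clear.
  by case: eqP; case: eqP; case: eqP => *; split; lia.
have nc : det3 P1 P2 P3 != 0 by rewrite -det_mx3.
have [Q1 [c1 [hc1 hQ1]]] := tangent_line hP1.
have [Q2 [c2 [hc2 hQ2]]] := tangent_line hP2.
have [Q3 [c3 [hc3 hQ3]]] := tangent_line hP3.
have low := low_weight_support hq hF hP1 hP2 hP3 h12 h13 h23 nc hc1 hc2 hc3 hQ1 hQ2 hQ3 hd5 dq
  ha1 ha2 ha3 b12 b13 b23 hsum.
split.
- exact: card_Bset.
- exact: (code_dimE hq hF hP1 hP2 hP3 h12 h13 h23 nc hc1 hc2 hc3 hQ1 hQ2 hQ3 hd5 dq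
    ha1 ha2 ha3 b12 b13 b23 hsum).
- exact: (exists_word_weight_d hq hF hP1 hP2 hP3 h12 h13 h23 nc hc1 hc2 hc3 hQ1 hQ2 hQ3 hd5 dq
    ha1 ha2 ha3 b12 b13 b23 hsum).
- exact: (weight_ge hq hF hP1 hP2 hP3 h12 h13 h23 nc hc1 hc2 hc3 hQ1 hQ2 hQ3 hd5 dq
    ha1 ha2 ha3 b12 b13 b23 hsum).
move=> w wC w0; split=> [wd|[i [wd _]]]; last by rewrite -card_suppB.
have [|_ line] := low w wC w0; first by rewrite wd.
have sub (P Q : 'rV[F]_3) : {in suppB w, forall x, det3 x P Q = 0} ->
    suppB w \subset Bset q P1 P2 P3 :&: line_through P Q.
  move=> wl; apply/subsetP=> x xw; rewrite in_setI (subsetP (suppB_sub w)) //=.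
  by rewrite inE det_mx3 wl.
by case: line => wl; [exists (@Ordinal 3 0 isT)|exists (@Ordinal 3 1 isT)|exists (@Ordinal 3 2 isT)];
  rewrite card_suppB; split=> //; apply: sub.
Qed.
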